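(* Let $u_0^*$ be a compactly supported signed Radon measure on $\mathbb{R}^d$ with finite total variation, and let $u(x,t)=(G(\cdot,t)*u_0^* )(x)$ for $t>0$ be the corresponding solution of the heat equation $\partial_t u-\Delta u=0$, $u(\cdot,0)=u_0^*$. Let $R>0$ be such that $\operatorname{supp}(u_0^* )\subseteq[-R,R]^d=:\Omega$. Fix $k\in\mathbb{Z}_+$ with $k\ge 1$ and $T>0$, let $\mathbf{y}=(y_\alpha)_{\|\alpha\|_1\le k}$ be any real vector, and define the observation error $\epsilon=(\epsilon_\alpha)_{\|\alpha\|_1\le k}$ by $\epsilon_\alpha=y_\alpha-\int_{\mathbb{R}^d}x^\alpha u(x,T)\,dx$. Let $u_0^k$ be any solution of $(P_{\Omega,k})$ with data $\mathbf{y}$. Then $$\|u_0^k-u_0^*\|_{\mathrm{Kant}}\le \frac{C_d\,R\,\|u_0^*\|_{\mathrm{TV}}}{k}+C_{d,R}(k)\,\max\{T^{\lfloor k/2\rfloor},1\}\,\|\epsilon\|_\infty,$$ where $C_d>0$ is a constant depending only on $d$ and $$C_{d,R}(k)=\Big(\sqrt{\tfrac{k}{\pi}}+\tfrac{C_d R}{\sqrt{\pi k}}\Big)\exp\Big(k\big(1+2d/R+\ln\sqrt{k}\big)\Big).$$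
   Context: Heat kernel: $G(x,t)=(4\pi t)^{-d/2}\exp(-\|x\|^2/(4t))$ for $(x,t)\in\mathbb{R}^d\times(0,\infty)$. Multi-index notation: $x^\alpha=x_1^{\alpha_1}\cdots x_d^{\alpha_d}$, $\|\alpha\|_1=\sum_i\alpha_i$; $\|\epsilon\|_\infty=\max_\alpha|\epsilon_\alpha|$. $\mathcal{M}(\Omega)$ is the space of signed Radon measures on $\Omega$ with finite total variation, $\|\cdot\|_{\mathrm{TV}}$ the total variation norm. $A$ is the matrix indexed by $\{\alpha\in\mathbb{Z}_+^d:\|\alpha\|_1\le k\}$ with $A_{\alpha,\alpha'}=\alpha_i(\alpha_i-1)$ if $\alpha'=\alpha-2e_i$ for some $i$, and $0$ otherwise. Problem $(P_{\Omega,k})$: minimize $\|u_0\|_{\mathrm{TV}}$ over $u_0\in\mathcal{M}(\Omega)$ subject to $\int_\Omega x^\alpha\,du_0(x)=(e^{-TA}\mathbf{y})_\alpha$ for all $\|\alpha\|_1\le k$. Kantorovich norm: for $\mu\in\mathcal{M}(\Omega)$, $\|\mu\|_{\mathrm{Kant}}=\max\{\int_\Omega v\,d\mu: v\in\mathcal{C}(\Omega),\ \sup_\Omega|v|\le 1,\ \mathrm{Lip}(v)\le 1\}$, with Lipschitz constant w.r.t. the Euclidean norm. *)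

(* Defs.v *)
From HB Require Import structures.
From mathcomp Require Import all_boot all_order all_algebra.
From mathcomp Require Import all_classical all_reals all_analysis.
Set Implicit Arguments. Unset Strict Implicit. Unset Printing Implicit Defensive.
Import Order.TTheory GRing.Theory Num.Theory.
Import numFieldNormedType.Exports.
Local Open Scope classical_set_scope.
Local Open Scope ring_scope.

(* Points of R^d are d-tuples of reals; d.-tuple R carries the product
   (= Borel) sigma-algebra of the Borel sigma-algebra on R. *)

Section HeatDefs.
Variable R : realType.

Section Space.
Variable d : nat.
Local Notation pt := (d.-tuple R).

Definition tsub (x y : pt) : pt := [tuple tnth x i - tnth y i | i < d].

Definition enorm (x : pt) : R := Num.sqrt (\sum_(i < d) tnth x i ^+ 2).

Definition heat_kernel (x : pt) (t : R) : R :=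
  powR (4 * pi * t) (- (d%:R / 2)) * expR (- (enorm x ^+ 2) / (4 * t)).

Definition cube (r : R) : set pt := [set x | forall i : 'I_d, - r <= tnth x i <= r].

(* A finite signed Borel measure on R^d (on R^d finite Borel measures are
   Radon), represented as the difference mu_plus - mu_minus of two finite
   measures.  Every quantity below depends only on the difference. *)
Record sgn_measure := SgnMeasure {
  mu_plus : {finite_measure set pt -> \bar R};
  mu_minus : {finite_measure set pt -> \bar R} }.

Definition sm_val (u : sgn_measure) (A : set pt) : R :=
  fine (mu_plus u A) - fine (mu_minus u A).

Definition sm_int (u : sgn_measure) (D : set pt) (f : pt -> R) : R :=
  Rintegral (mu_plus u) D f - Rintegral (mu_minus u) D f.

(* |u|(R^d \ Om) = 0, i.e. supp u is contained in the closed set Om,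
   equivalently u is (the extension by zero of) an element of M(Om) *)
Definition vanishes_outside (u : sgn_measure) (Om : set pt) : Prop :=
  forall A : set pt, measurable A -> A `<=` ~` Om -> sm_val u A = 0.

Definition tv_norm (u : sgn_measure) : R :=
  sup [set s | exists (n : nat) (A : 'I_n -> set pt),
        (forall i, measurable (A i)) /\
        (forall i j, i != j -> A i `&` A j = set0) /\
        s = \sum_(i < n) `| sm_val u (A i) | ].

(* Kantorovich norm of u - w as elements of M(Om):
   max { int_Om v d(u - w) : |v| <= 1 on Om, Lip(v) <= 1 on Om }
   (a 1-Lipschitz v on Om is automatically in C(Om)). *)
Definition kant_norm_diff (u w : sgn_measure) (Om : set pt) : R :=
  sup [set s | exists v : pt -> R,
        (forall x, Om x -> `| v x | <= 1) /\
        (forall x y, Om x -> Om y -> `| v x - v y | <= enorm (tsub x y)) /\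
        s = sm_int u Om v - sm_int w Om v ].

Definition heat_sol (u0 : sgn_measure) (x : pt) (t : R) : R :=
  sm_int u0 setT (fun y => heat_kernel (tsub x y) t).

(* multi-indices alpha in Z_+^d with entries <= k; the index set of the
   paper is { alpha | mdeg alpha <= k } *)
Definition mdeg (k : nat) (a : d.-tuple 'I_k.+1) : nat := \sum_(i < d) (tnth a i : nat).

Definition monom (k : nat) (a : d.-tuple 'I_k.+1) (x : pt) : R :=
  \prod_(i < d) tnth x i ^+ tnth a i.

Definition Amat (k : nat) (a b : d.-tuple 'I_k.+1) : R :=
  \sum_(i < d)
    (if ((tnth b i : nat) + 2 == tnth a i)%N &&
        [forall j : 'I_d, (j != i) ==> ((tnth b j : nat) == tnth a j)]
     then ((tnth a i : nat) * (tnth a i).-1)%:R else 0).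

Fixpoint Apow (k : nat) (j : nat) (a b : d.-tuple 'I_k.+1) : R :=
  match j with
  | 0 => (a == b)%:R
  | j'.+1 => \sum_(c : d.-tuple 'I_k.+1 | (mdeg c <= k)%N) Amat a c * Apow j' c b
  end.

Definition expA_y (k : nat) (t : R) (y : d.-tuple 'I_k.+1 -> R)
    (a : d.-tuple 'I_k.+1) : R :=
  limn (fun N : nat => \sum_(j < N) ((- t) ^+ j / (j`!)%:R) *
        \sum_(b : d.-tuple 'I_k.+1 | (mdeg b <= k)%N) Apow j a b * y b).

Definition feasible_P (Om : set pt) (k : nat) (T : R)
    (y : d.-tuple 'I_k.+1 -> R) (u : sgn_measure) : Prop :=
  vanishes_outside u Om /\
  forall a : d.-tuple 'I_k.+1, (mdeg a <= k)%N ->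
    sm_int u Om (monom a) = expA_y T y a.

Definition solves_P (Om : set pt) (k : nat) (T : R)
    (y : d.-tuple 'I_k.+1 -> R) (u : sgn_measure) : Prop :=
  feasible_P Om T y u /\
  forall w : sgn_measure, feasible_P Om T y w -> tv_norm u <= tv_norm w.

End Space.

(* Lebesgue integral on R^d, as the iterated integral over the coordinates
   (equal to the integral w.r.t. d-dim Lebesgue measure for integrable f,
   by Fubini). *)
Fixpoint leb_int (n : nat) : (n.-tuple R -> R) -> R :=
  match n return (n.-tuple R -> R) -> R with
  | 0 => fun f => f [tuple]
  | n'.+1 => fun f => Rintegral (@lebesgue_measure R) setT
                        (fun t : R => leb_int (fun x : n'.-tuple R => f (cons_tuple t x)))
  end.

Definition obs_err (d k : nat) (T : R) (y : d.-tuple 'I_k.+1 -> R)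
    (u0 : sgn_measure d) (a : d.-tuple 'I_k.+1) : R :=
  y a - leb_int (fun x : d.-tuple R => monom a x * heat_sol u0 x T).

Definition obs_err_norm (d k : nat) (T : R) (y : d.-tuple 'I_k.+1 -> R)
    (u0 : sgn_measure d) : R :=
  \big[Num.max/0]_(a : d.-tuple 'I_k.+1 | (mdeg a <= k)%N) `| obs_err T y u0 a |.

Definition CdR (d : nat) (Cd r : R) (k : nat) : R :=
  (Num.sqrt (k%:R / pi) + Cd * r / Num.sqrt (pi * k%:R)) *
  expR (k%:R * (1 + 2 * d%:R / r + ln (Num.sqrt k%:R))).

End HeatDefs.

(* Main.v *)
Require Import Defs.
From HB Require Import structures.
From mathcomp Require Import all_boot all_order all_algebra.
From mathcomp Require Import all_classical all_reals all_analysis.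
From mathcomp Require Import measurable_realfun ring lra zify.
Set Implicit Arguments. Unset Strict Implicit. Unset Printing Implicit Defensive.
Import Order.TTheory GRing.Theory Num.Theory.
Import numFieldNormedType.Exports.
Local Open Scope classical_set_scope.
Local Open Scope ring_scope.

(* For every data vector [delta] there is an explicit discrete signed measure on
   the cube with these moments, so correcting the true initial measure by it
   yields a feasible competitor [u'].  By minimality the solution has total
   variation at most [tv u'].  The solution and [u'] have the same moments up to
   degree [k], hence integrating a test function [v] against their difference
   only sees [v - p] for a polynomial [p] of degree at most [k], and Jackson's
   theorem makes [v - p] of size [r / k].  The rest is controlled by the mass of
   the correction.

   That mass is bounded as follows.  The functional [p |-> p^(j)(0)] on
   polynomials of degree at most [k] is a combination of point evaluations in
   [-1, 1] with total weight at most [(2k)^j]: substituting [x = cos t], Riesz's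
   interpolation formula realizes the operator [(1 - x^2) p'' - x p'] with weight
   [k^2], and [p^(j+2)(0)] is the [j]-th derivative at 0 of this operator applied
   to [p], plus [j^2 p^(j)(0)].  Tensor products over the multi-indices then sum
   to [exp (2 d k / r)].  The perturbation of the moments is [e^(-TA) eps], whose
   size is read off the row sums of the powers of [A]; and [e^(-TA)] inverts the
   heat flow on moments because the moments of a heat kernel are heat
   polynomials, which are polynomial in time with derivative given by [A]. *)

(** * Chebyshev polynomials *)

Section Trig.
Variable R : realType.
Implicit Types (x c h t : R) (p : {poly R}).

Lemma cosM2 x h : cos x * sin h *+ 2 = sin (x + h) - sin (x - h).
Proof. rewrite sinD sinB; ring. Qed.

Lemma cos_mul2 x h : cos x * cos h *+ 2 = cos (x + h) + cos (x - h).
Proof. rewrite cosD cosB; ring. Qed.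

Lemma sin_periodn (m : nat) x : sin (x + pi * 2 * m%:R) = sin x.
Proof.
have -> : pi * 2 * m%:R = pi *+ 2 *+ m :> R by rewrite (mulr_natr pi 2) mulr_natr.
by rewrite periodicn//; exact: sinD2pi.
Qed.

(** Multiplied by [2 sin (h / 2)], each term becomes a difference of sines and the sum telescopes.
    The two end points differ by the angle [N h], a multiple of the period. *)
Lemma sum_cos_progression (N m : nat) (h c : R) :
  N%:R * h = pi * 2 * m%:R -> sin (h / 2) != 0 ->
  \sum_(q < N) cos (q%:R * h + c) = 0.
Proof.
move=> hN hs.
suff /eqP : (\sum_(q < N) cos (q%:R * h + c)) * sin (h / 2) *+ 2 = 0.
  by rewrite mulrn_eq0/= mulf_eq0 (negPf hs) orbF => /eqP.
rewrite mulr_suml -sumrMnl.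
rewrite -(big_mkord xpredT (fun q => cos (q%:R * h + c) * sin (h / 2) *+ 2)).
rewrite (telescope_sumr_eq (fun i => sin (i%:R * h + (c - h / 2))))//; last first.
  move=> i _; rewrite cosM2; congr (sin _ - sin _); last by ring.
  by rewrite -natr1; field.
rewrite /= hN mul0r add0r.
by rewrite [X in sin X - _]addrC sin_periodn subrr.
Qed.

(** The pair holds two consecutive Chebyshev polynomials of the first kind, which makes the
    three-term recurrence structural. *)
Fixpoint cheb2 (n : nat) : {poly R} * {poly R} :=
  if n is n'.+1 then
    let: (a, b) := cheb2 n' in (b, 'X * b *+ 2 - a)
  else (1, 'X).

Definition cheb n := (cheb2 n).1.

Lemma cheb0 : cheb 0 = 1. Proof. by []. Qed.
Lemma cheb1 : cheb 1 = 'X. Proof. by []. Qed.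
Lemma chebSS n : cheb n.+2 = 'X * cheb n.+1 *+ 2 - cheb n.
Proof. by rewrite /cheb /=; case: (cheb2 n). Qed.

Lemma nat_ind2 (P : nat -> Prop) :
  P 0%N -> P 1%N -> (forall n, P n -> P n.+1 -> P n.+2) -> forall n, P n.
Proof.
move=> h0 h1 hS n; suff: P n /\ P n.+1 by case.
by elim: n => [//|n [a b]]; split => //; exact: hS.
Qed.

Lemma cheb_cos n t : (cheb n).[cos t] = cos (n%:R * t).
Proof.
elim/nat_ind2: n => [||n ih0 ih1]; rewrite ?cheb0 ?cheb1 ?hornerE ?mul0r ?cos0 ?mul1r//.
rewrite chebSS hornerD hornerN hornerMn hornerM hornerX ih1 ih0 mulrC cos_mul2.
have -> : n.+1%:R * t + t = n.+2%:R * t by rewrite -[in RHS]natr1; ring.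
have -> : n.+1%:R * t - t = n%:R * t by rewrite -natr1; ring.
by rewrite addrK.
Qed.

Lemma size_cheb n : (size (cheb n) <= n.+1)%N.
Proof.
elim/nat_ind2: n => [||n ih0 ih1]; rewrite ?cheb0 ?cheb1 ?size_poly1 ?size_polyX//.
rewrite chebSS (leq_trans (size_polyD _ _))// geq_max size_polyN; apply/andP; split.
  rewrite mulr2n (leq_trans (size_polyD _ _))// maxnn.
  have [->|h] := eqVneq (cheb n.+1) 0; first by rewrite mulr0 size_poly0.
  by rewrite mulrC size_mulX.
by rewrite (leq_trans ih0)// ltnW.
Qed.

Lemma coef_cheb_neq0 n : (cheb n)`_n != 0.
Proof.
suff: 0 < (cheb n)`_n by apply: lt0r_neq0.
elim/nat_ind2: n => [||n ih0 ih1]; rewrite ?cheb0 ?cheb1 ?coef1 ?coefX//.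
rewrite chebSS coefB coefMn coefXM /= (nth_default _ (leq_trans (size_cheb n) _))//.
by rewrite subr0 pmulrn_lgt0.
Qed.

Lemma cheb_basis n p : (size p <= n.+1)%N ->
  exists c : nat -> R, p = \sum_(m < n.+1) c m *: cheb m.
Proof.
elim: n p => [|n ih] p sp.
  exists (fun=> p`_0); rewrite big_ord1 cheb0 alg_polyC.
  by apply: size1_polyC.
pose q := p - (p`_n.+1 / (cheb n.+1)`_n.+1) *: cheb n.+1.
have sq : (size q <= n.+1)%N.
  apply/leq_sizeP => j; rewrite leq_eqVlt => /predU1P[<-|hj].
    by rewrite coefB coefZ divfK ?subrr// coef_cheb_neq0.
  rewrite coefB coefZ (nth_default _ (leq_trans sp hj)).
  by rewrite (nth_default _ (leq_trans (size_cheb _) hj)) mulr0 subr0.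
have [c hc] := ih _ sq.
exists (fun m => if m == n.+1 then p`_n.+1 / (cheb n.+1)`_n.+1 else c m).
rewrite big_ord_recr /= eqxx.
under eq_bigr => i _ do rewrite ltn_eqF//.
by rewrite -hc /q subrK.
Qed.

End Trig.

(** * Riesz's interpolation formula *)

Section Riesz.
Variables (R : realType) (k : nat).
Hypothesis k_gt0 : (0 < k)%N.

Let kR : (0 : R) < k%:R. Proof. by rewrite ltr0n. Qed.

(** For [r < 2k] these are the zeros of [cos (k x)] in one period. *)
Definition riesz_node (r : nat) : R := (r.*2.+1)%:R * pi / (k.*2)%:R.
Definition riesz_sqsin r : R := sin (riesz_node r / 2) ^+ 2.
Let s := riesz_sqsin.
Let th := riesz_node.
Let g (m : nat) : R := \sum_(r < k.*2) (-1) ^+ r / s r * sin (m%:R * th r).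

Lemma riesz_sqsin_gt0 r : (r < k.*2)%N -> 0 < s r.
Proof.
move=> hr; rewrite exprn_gt0// sin_gt0_pi// /riesz_node.
have h2 : (0 : R) < (k.*2)%:R by rewrite ltr0n double_gt0.
have e : r.*2.+1%:R * pi / k.*2%:R / 2 = (r.*2.+1%:R / (k.*2.*2)%:R) * pi :> R.
  by rewrite -(muln2 k.*2) natrM; field; rewrite lt0r_neq0.
rewrite e; apply/andP; split; first by rewrite mulr_gt0 ?pi_gt0// divr_gt0// ltr0n ?double_gt0// double_gt0.
rewrite -[ltRHS]mul1r ltr_pM2r ?pi_gt0// ltr_pdivrMr ?mul1r ?ltr_nat; last by rewrite ltr0n !double_gt0.
by lia.
Qed.

Lemma riesz_alt m : (m < k)%N -> \sum_(r < k.*2) (-1) ^+ r * sin (m%:R * th r) = 0.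
Proof.
move=> mk.
have k0 : k%:R != 0 :> R by rewrite lt0r_neq0.
have h2 : (k.*2)%:R = 2 * k%:R :> R by rewrite -muln2 natrM mulrC.
(* The sign is absorbed as a shift of the angle by [r pi], and the sine becomes a cosine shifted by
   [pi / 2]. The progression then has step [h], with [2k h = 2 pi (m + k)]; the condition [m < k]
   keeps [h / 2] below [pi]. *)
pose h : R := m%:R * pi / k%:R + pi.
pose c : R := m%:R * pi / (2 * k%:R) - pi / 2.
rewrite -[RHS](@sum_cos_progression R k.*2 (m + k) h c).
- apply: eq_bigr => r _.
  rewrite -(alternatingn (@sinDpi R)) -cosBpihalf; congr cos.
  rewrite /th /riesz_node /h /c h2 -mulr_natl -natr1 -muln2 natrM; field.
  exact: k0.
- by rewrite /h h2 natrD; field; exact: k0.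
- have -> : h / 2 = ((m + k)%:R / (k.*2)%:R) * pi.
    by rewrite /h h2 natrD; field; exact: k0.
  rewrite lt0r_neq0// sin_gt0_pi//; apply/andP; split.
    by rewrite mulr_gt0 ?pi_gt0// divr_gt0// ltr0n ?double_gt0// addn_gt0 k_gt0 orbT.
  rewrite -[ltRHS]mul1r ltr_pM2r ?pi_gt0// ltr_pdivrMr ?mul1r ?ltr_nat; last by rewrite ltr0n !double_gt0.
  by lia.
Qed.

(* [g] is linear up to [k] because its second differences vanish there; its value
   at [k] is the normalizing constant [S] below. *)
Lemma riesz_second_diff m : (m.+1 < k)%N -> g m.+2 = g m.+1 *+ 2 - g m.
Proof.
move=> mk; apply/eqP; rewrite -subr_eq0; apply/eqP.
have := riesz_alt mk; move/(congr1 (fun z => z * (- 4))); rewrite mul0r => <-.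
rewrite /g -sumrMnl -sumrB -sumrB mulr_suml; apply: eq_bigr => r _.
have sr := lt0r_neq0 (riesz_sqsin_gt0 (ltn_ord r)).
have e2 : sin (m.+2%:R * th r) = sin (m.+1%:R * th r + th r).
  by congr sin; rewrite -[in LHS]natr1; ring.
have e0 : sin (m%:R * th r) = sin (m.+1%:R * th r - th r).
  by congr sin; rewrite -[in RHS]natr1; ring.
have e1 : cos (th r) = 1 - s r *+ 2.
  have -> : th r = (th r / 2) *+ 2 by rewrite -mulr_natr; field.
  by rewrite cos_mulr2n cos2sin2 /s /riesz_sqsin; ring.
by rewrite e2 e0 sinD sinB e1; field.
Qed.

Lemma riesz_linear m : (m <= k)%N -> g m = m%:R * g 1.
Proof.
elim/nat_ind2: m => [_||m ih0 ih1 mk].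
- by rewrite mul0r /g big1// => r _; rewrite mul0r sin0 mulr0.
- by rewrite mul1r.
- rewrite riesz_second_diff// ih0 ?ih1; [|lia..].
  by rewrite -[m.+2%:R]natr1 -[m.+1%:R]natr1; ring.
Qed.

Let S : R := \sum_(r < k.*2) (s r)^-1.

(** At a node [sin (k x)] equals [(-1)^r], which cancels the alternating sign. *)
Lemma riesz_top : g k = S.
Proof.
apply: eq_bigr => r _.
have -> : k%:R * th r = pi / 2 + pi *+ r.
  have e1 : r.*2.+1%:R = 2 * r%:R + 1 :> R by rewrite -natr1 -muln2 natrM mulrC.
  have e2 : (k.*2)%:R = 2 * k%:R :> R by rewrite -muln2 natrM mulrC.
  rewrite /th /riesz_node e1 e2 -(mulr_natr pi r); field.
  by rewrite lt0r_neq0.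
by rewrite (alternatingn (@sinDpi R)) sin_pihalf mulr1 mulrAC -expr2 sqrr_sign mul1r.
Qed.

Lemma riesz_sum_gt0 : 0 < S.
Proof.
have hk : (0 < k.*2)%N by rewrite double_gt0.
rewrite /S (bigD1 (Ordinal hk))//= ltr_pwDl// ?invr_gt0 ?riesz_sqsin_gt0//.
by apply: sumr_ge0 => r _; rewrite invr_ge0 ltW// riesz_sqsin_gt0.
Qed.

(** Linearity gives [g m = m S / k], so the factor [k / S] turns the sine sums into [m]; it also
    makes the total absolute weight equal to [k]. *)
Definition riesz_weight (r : nat) : R := (-1) ^+ r / s r * k%:R / S.
Let w := riesz_weight.

Lemma riesz_sum_sin m : (m <= k)%N -> \sum_(r < k.*2) w r * sin (m%:R * th r) = m%:R.
Proof.
move=> mk; have S0 := lt0r_neq0 riesz_sum_gt0; have k0 := lt0r_neq0 kR.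
have -> : \sum_(r < k.*2) w r * sin (m%:R * th r) = g m * (k%:R / S).
  by rewrite /g mulr_suml; apply: eq_bigr => r _; rewrite /w /riesz_weight; ring.
have h := riesz_top; rewrite riesz_linear// in h.
have g0 : g 1 != 0 by move: S0; rewrite -h mulf_eq0 negb_or => /andP[].
by rewrite riesz_linear// -h; field; rewrite g0 k0.
Qed.

(** The reflection [r |-> 2k - 1 - r] sends a node to [2 pi] minus itself. It fixes the cosines and
    reverses the sign of the weights, because it changes the parity of [r]. *)
Lemma riesz_sum_cos m : \sum_(r < k.*2) w r * cos (m%:R * th r) = 0.
Proof.
set A := LHS; suff : A = - A by lra.
rewrite {1}/A (reindex_inj rev_ord_inj) /= -sumrN; apply: eq_bigr => r _.
have k0 := lt0r_neq0 kR.
have e : th (k.*2 - r.+1)%N = pi *+ 2 - th r.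
  rewrite /th /riesz_node.
  have -> : (k.*2 - r.+1).*2.+1%:R = 2 * (k.*2)%:R - r.*2.+1%:R :> R.
    have := ltn_ord r; set n := k.*2 => rn.
    by rewrite -natrM -natrB; [congr (_%:R); lia|lia].
  rewrite -(mulr_natr pi 2); field.
  by rewrite lt0r_neq0// ltr0n double_gt0.
have -> : cos (m%:R * th (k.*2 - r.+1)%N) = cos (m%:R * th r).
  have -> : m%:R * th (k.*2 - r.+1) = - (m%:R * th r) + pi *+ 2 *+ m.
    by rewrite e -[_ *+ 2 *+ m]mulr_natr; ring.
  by rewrite periodicn ?cosN//; exact: cosD2pi.
have -> : w (k.*2 - r.+1) = - w r.
  have es : s (k.*2 - r.+1) = s r.
    rewrite /s /riesz_sqsin -/th e; have -> : (pi *+ 2 - th r) / 2 = pi - th r / 2 by field.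
    by rewrite sinB sinpi cospi mul0r sub0r mulN1r opprK.
  rewrite /w /riesz_weight es -signr_odd.
  have -> : odd (k.*2 - r.+1) = ~~ odd r.
    by rewrite oddB ?odd_double //= addbF.
  by rewrite -(signr_odd _ r); case: (odd r); rewrite /= ?expr0 ?expr1; ring.
by rewrite mulNr.
Qed.

Lemma riesz_norm : \sum_(r < k.*2) `|w r| = k%:R.
Proof.
have S0 := riesz_sum_gt0.
have -> : k%:R = S * (k%:R / S) by field; rewrite lt0r_neq0.
rewrite mulr_suml; apply: eq_bigr => r _.
rewrite /w /riesz_weight -!mulrA !normrM normrX normrN1 expr1n mul1r.
by rewrite !ger0_norm ?invr_ge0 ?ltW// riesz_sqsin_gt0.
Qed.

End Riesz.

Section RieszPoly.
Variables (R : realType).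
Implicit Types (p : {poly R}) (t : R).

Lemma is_derive_horner_cos p t c :
  is_derive t 1 (fun u : R => p.[cos (u + c)]) (- (p^`().[cos (t + c)] * sin (t + c))).
Proof.
have h : is_derive t (1 : R) (fun u : R => u + c) 1.
  by apply: is_derive_eq; rewrite addr0.
have hc : is_derive t (1 : R) (cos \o (fun u : R => u + c)) (- sin (t + c) * 1).
  exact: is_derive1_comp.
have := @is_derive1_comp R (horner p) (cos \o (fun u : R => u + c)) t _ _ (is_derive_poly p _) hc.
by rewrite mulr1 mulrN.
Qed.

Lemma is_derive_unique (f : R -> R) t a b : is_derive t 1 f a -> is_derive t 1 f b -> a = b.
Proof. by move=> [_ <-] [_ <-]. Qed.

(** Both sides are, up to sign, the derivative of [cos (m t)], seen also as a Chebyshev polynomial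
    in [cos t]. *)
Lemma deriv_cheb_cos m t : (cheb R m)^`().[cos t] * sin t = m%:R * sin (m%:R * t).
Proof.
apply: oppr_inj.
have h1 := is_derive_horner_cos (cheb R m) t 0; rewrite !addr0 in h1.
apply: is_derive_unique h1 _.
have -> : (fun u : R => (cheb R m).[cos (u + 0)]) = cos \o (fun u => m%:R * u).
  by apply/funext => u /=; rewrite addr0 cheb_cos.
have h : is_derive t (1 : R) (fun u : R => m%:R * u) m%:R.
  have := is_deriveZ m%:R (is_derive_id t (1 : R)).
  by rewrite /GRing.scale /= mulr1.
have := @is_derive1_comp R cos (fun u => m%:R * u) t _ _ (is_derive_cos _) h.
by rewrite mulNr mulrC.
Qed.

Variable k : nat.
Hypothesis k_gt0 : (0 < k)%N.
Local Notation w := (riesz_weight R k).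
Local Notation th := (riesz_node R k).

(** Riesz's formula for the derivative of [t |-> p (cos t)]. By linearity it suffices to take [p] a
    Chebyshev polynomial; after expanding [cos (m t + m th)] the cosine sums vanish and the sine
    sums give [m]. *)
Lemma riesz_deriv p t : (size p <= k.+1)%N ->
  - (p^`().[cos t] * sin t) = \sum_(r < k.*2) w r * p.[cos (t + th r)].
Proof.
move=> sp; have [c ->] := cheb_basis sp.
rewrite linear_sum horner_sum.
under [RHS]eq_bigr do rewrite horner_sum mulr_sumr.
rewrite exchange_big /= mulr_suml -sumrN; apply: eq_bigr => m _.
rewrite derivZ hornerZ -mulrA deriv_cheb_cos.
under eq_bigr => r _.
  rewrite hornerZ cheb_cos mulrDr cosD.
  have -> : w r * (c m * (cos (m%:R * t) * cos (m%:R * th r) - sin (m%:R * t) * sin (m%:R * th r)))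
     = c m * cos (m%:R * t) * (w r * cos (m%:R * th r)) - c m * sin (m%:R * t) * (w r * sin (m%:R * th r)) by ring.
  over.
rewrite sumrB -!mulr_sumr riesz_sum_cos// riesz_sum_sin//; last by rewrite -ltnS.
by ring.
Qed.

(** In the variable [x = cos t] this is the second derivative in [t]. *)
Definition cheb_op p : {poly R} := (1 - 'X ^+ 2) * p^`()^`() - 'X * p^`().

Lemma riesz_deriv2 p t : (size p <= k.+1)%N ->
  (cheb_op p).[cos t] = \sum_(r < k.*2) w r * \sum_(s < k.*2) w s * p.[cos (t + th r + th s)].
Proof.
move=> sp.
transitivity (\sum_(r < k.*2) w r * - (p^`().[cos (t + th r)] * sin (t + th r))); last first.
  by apply: eq_bigr => r _; rewrite riesz_deriv.
(* [F] is the derivative of [t |-> p (cos t)]. Differentiating its interpolation form and its closed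
   form yields the two sides. *)
pose F (u : R) := \sum_(r < k.*2) w r * p.[cos (u + th r)].
have h1 : is_derive t (1 : R) F (\sum_(r < k.*2) w r * - (p^`().[cos (t + th r)] * sin (t + th r))).
  rewrite /F.
  have -> : (fun u : R => \sum_(r < k.*2) w r * p.[cos (u + th r)]) =
    \sum_(r < k.*2) (w r *: (fun u : R => p.[cos (u + th r)])).
    by apply/funext => u; rewrite fct_sumE.
  apply: is_derive_sum => r.
  by apply: is_deriveZ; exact: is_derive_horner_cos.
apply: is_derive_unique h1.
have -> : F = (fun u => - (p^`().[cos (u + 0)] * sin u)).
  by apply/funext => u; rewrite /F -riesz_deriv// addr0.
have h3 := is_derive_horner_cos p^`() t 0.
have h4 := @is_deriveN _ _ _ _ _ _ _ (is_deriveM h3 (is_derive_sin t)).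
apply: is_derive_eq.
rewrite !addr0 /cheb_op !hornerE /= /GRing.scale /=.
have := cos2Dsin2 t => e.
have -> : 1 - cos t ^+ 2 = sin t ^+ 2 by rewrite -e; ring.
by ring.
Qed.

Lemma coef_cheb_op p j :
  (cheb_op p)`_j = p`_j.+2 * (j.+2 * j.+1)%:R - p`_j * (j ^ 2)%:R.
Proof.
rewrite /cheb_op mulrBl mul1r !coefB coefXnM coefXM !coef_deriv.
case: j => [|[|j]] /=; rewrite ?subSS ?subn0 /=; ring.
Qed.

Lemma size_cheb_op p : (size p <= k.+1)%N -> (size (cheb_op p) <= k.+1)%N.
Proof.
move=> sp; apply/leq_sizeP => j hj.
rewrite coef_cheb_op !nth_default ?mul0r ?subr0//; first exact: leq_trans sp hj.
by rewrite (leq_trans sp)// (leq_trans hj)// -addn2 leq_addr.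
Qed.

(** Nodes are stored as angles: Riesz's formula then acts by shifting them, and the points [cos z.2]
    stay in [-1, 1]. The point 0 is the angle [pi / 2], and the induction goes by steps of two. *)
Lemma coef0_functional j : (j <= k)%N ->
  exists s : seq (R * R), \sum_(z <- s) `|z.1| <= (2 * k%:R) ^+ j /\
    forall p, (size p <= k.+1)%N ->
      p`_j * (j`!)%:R = \sum_(z <- s) z.1 * p.[cos z.2].
Proof.
have kR : (0 : R) < k%:R by rewrite ltr0n.
elim/nat_ind2: j => [_|_|j ih _ jk].
- exists [:: (1, pi / 2)]; rewrite big_seq1 normr1 expr0; split => // p _.
  by rewrite big_seq1 cos_pihalf horner_coef0 mul1r mulr1.
- exists [seq (- w r, pi / 2 + th r) | r <- index_iota 0 k.*2].
  rewrite big_map; split.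
    under eq_bigr do rewrite normrN.
    by rewrite big_mkord riesz_norm// expr1 ler_pMl// ler1n.
  move=> p sp; rewrite big_map big_mkord /= mulr1.
  under eq_bigr do rewrite mulNr.
  rewrite sumrN -riesz_deriv// opprK cos_pihalf sin_pihalf mulr1 horner_coef0 coef_deriv.
  by rewrite mulr1n.
- have [s [hs hp]] := ih ltac:(lia).
  pose s' := [seq (z.1 * w r.1 * w r.2, z.2 + th r.1 + th r.2) | z <- s,
      r <- [seq (a, b) | a <- index_iota 0 k.*2, b <- index_iota 0 k.*2]]
      ++ [seq ((j ^ 2)%:R * z.1, z.2) | z <- s].
  exists s'; rewrite /s' big_cat /= big_map /=; split.
    rewrite big_allpairs_dep /=.
    have -> : \sum_(z <- s) \sum_(r <- [seq (a, b) | a <- index_iota 0 k.*2, b <- index_iota 0 k.*2])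
       `|z.1 * w r.1 * w r.2| = (\sum_(z <- s) `|z.1|) * k%:R ^+ 2.
      rewrite mulr_suml; apply: eq_bigr => z _.
      rewrite big_allpairs_dep /= big_mkord -[in RHS](riesz_norm R k_gt0) expr2 !mulr_sumr.
      apply: eq_bigr => a _.
      rewrite mulr_suml mulr_sumr big_mkord; apply: eq_bigr => b _.
      by rewrite !normrM; ring.
    under [X in _ + X]eq_bigr do rewrite normrM normr_nat.
    rewrite -mulr_sumr mulrC -mulrDl.
    (* The double interpolation costs [k^2] and the correction term [j^2]; since [j <= k], together
       they stay below [(2k)^2]. *)
    apply: (@le_trans _ _ ((k%:R ^+ 2 + (j ^ 2)%:R) * (2 * k%:R) ^+ j)).
      by rewrite ler_wpM2l// addr_ge0// ?exprn_ge0.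
    rewrite [in leRHS]exprS [in leRHS]exprS mulrA ler_wpM2r//.
    have : (j%:R : R) <= k%:R by rewrite ler_nat; lia.
    by rewrite natrX => hj; have : (0 : R) <= j%:R by []; nra.
  move=> p sp.
  rewrite big_cat big_map /= big_allpairs_dep /=.
  under eq_bigr => z _.
    rewrite big_allpairs_dep /=.
    have -> : \sum_(a <- index_iota 0 k.*2) \sum_(b <- index_iota 0 k.*2)
      z.1 * w a * w b * p.[cos (z.2 + th a + th b)] = z.1 * (cheb_op p).[cos z.2].
      rewrite riesz_deriv2// mulr_sumr big_mkord; apply: eq_bigr => a _.
      rewrite big_mkord !mulr_sumr; apply: eq_bigr => b _; ring.
    over.
  under [X in _ + X]eq_bigr do rewrite -mulrA.
  rewrite -mulr_sumr -!hp//; last exact: size_cheb_op.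
  by rewrite coef_cheb_op !factS !natrM; ring.
Qed.
End RieszPoly.

(** * Jackson kernels *)

Lemma sin_le_id (R : realType) (x : R) : 0 <= x -> sin x <= x.
Proof.
rewrite le_eqVlt => /predU1P[<-|x0]; first by rewrite sin0.
have [c _] : exists2 c, c \in `]0, x[%R & sin x - sin 0 = cos c * (x - 0).
  apply: (@MVT _ sin cos) => //.
  by apply: continuous_subspaceT => y; exact: continuous_sin.
rewrite sin0 !subr0 => ->.
by rewrite ger_pMl// cos_le1.
Qed.

Section Jackson.
Variables (R : realType) (n : nat).
Implicit Types (x t : R).

Let M := n.+2.
Let N := M.*2.
Let h : R := pi / M%:R.
(** Coefficients of the Fejer-Korovkin kernel, which maximize the first Fourier coefficient among
    normalized squared moduli of trigonometric polynomials of degree [n]. That coefficient governs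
    the approximation error. *)
Let a (j : nat) : R := sin (j.+1%:R * h).
Let phi (q : nat) : R := q%:R * (pi * 2 / N%:R).
Let S : R := \sum_(j < n.+1) a j ^+ 2.
Let df (j l : nat) : nat := ((j - l) + (l - j))%N.

Let MR : (0 : R) < M%:R. Proof. by rewrite ltr0n. Qed.
Let NR : (0 : R) < N%:R. Proof. by rewrite ltr0n. Qed.

Lemma jackson_S_gt0 : 0 < S.
Proof.
rewrite /S big_ord_recl ltr_pwDl//; last by apply: sumr_ge0 => j _; exact: sqr_ge0.
rewrite exprn_gt0// /a mul1r sin_gt0_pi// /h divr_gt0 ?pi_gt0 ?MR//=.
by rewrite ltr_pdivrMr ?MR// ltr_pMr ?pi_gt0// ltr1n.
Qed.

Lemma sum_cos_grid (m : nat) (c : R) : (0 < m < N)%N ->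
  \sum_(q < N) cos (m%:R * phi q + c) = 0.
Proof.
move=> /andP[m0 mN].
have N0 := lt0r_neq0 NR.
rewrite -[RHS](@sum_cos_progression R N m (m%:R * (pi * 2 / N%:R)) c).
- by apply: eq_bigr => q _; congr (cos (_ + _)); rewrite /phi; ring.
- by field.
- have -> : m%:R * (pi * 2 / N%:R) / 2 = m%:R / N%:R * pi :> R by field.
  rewrite lt0r_neq0// sin_gt0_pi//; apply/andP; split.
    by rewrite mulr_gt0 ?pi_gt0// divr_gt0// ?NR// ltr0n.
  by rewrite -[ltRHS]mul1r ltr_pM2r ?pi_gt0// ltr_pdivrMr ?NR// mul1r ltr_nat.
Qed.

Lemma cos_df (j l : nat) x : cos ((df j l)%:R * x) = cos ((j%:R - l%:R) * x).
Proof.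
rewrite /df; have [jl|lj] := leqP j l.
  by rewrite (eqP jl) add0n natrB// -cosN; congr cos; ring.
have /eqP -> : (l - j == 0)%N by rewrite subn_eq0 ltnW.
by rewrite addn0 natrB// ltnW.
Qed.

Definition jackson_node (q : nat) : R := cos (phi q).
(** At [cos t] this is the normalized mean of the kernel at [t + phi q] and [t - phi q];
    symmetrizing in [t] is what makes it a polynomial in [cos t]. Summing values at the nodes
    against these polynomials is a discretized convolution with the kernel. *)
Definition jackson_poly (q : nat) : {poly R} :=
  (N%:R * S)^-1 *: \sum_(j < n.+1) \sum_(l < n.+1)
     (a j * a l * cos ((df j l)%:R * phi q)) *: cheb R (df j l).

Lemma size_jackson_poly q : (size (jackson_poly q) <= n.+1)%N.
Proof.
rewrite (leq_trans (size_scale_leq _ _))// (leq_trans (size_sum _ _ _))//.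
apply/bigmax_leqP => j _; rewrite (leq_trans (size_sum _ _ _))//.
apply/bigmax_leqP => l _; rewrite (leq_trans (size_scale_leq _ _))//.
rewrite (leq_trans (size_cheb _ _))// /df.
by have := ltn_ord j; have := ltn_ord l; lia.
Qed.

(** The squared modulus of the trigonometric polynomial with coefficients [a j], hence
    nonnegative. *)
Let K (t : R) : R := (\sum_(j < n.+1) a j * cos (j%:R * t)) ^+ 2 + (\sum_(j < n.+1) a j * sin (j%:R * t)) ^+ 2.

Lemma jackson_kernelE t : K t = \sum_(j < n.+1) \sum_(l < n.+1) a j * a l * cos ((j%:R - l%:R) * t).
Proof.
rewrite /K !expr2 !mulr_suml -big_split/=; apply: eq_bigr => j _.
rewrite !mulr_sumr -big_split/=; apply: eq_bigr => l _.
by rewrite mulrBl cosB; ring.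
Qed.

Lemma jackson_poly_cos q t : (jackson_poly q).[cos t] =
  (N%:R * S)^-1 * ((K (t + phi q) + K (t - phi q)) / 2).
Proof.
rewrite /jackson_poly hornerZ; congr (_ * _).
rewrite !jackson_kernelE -big_split /= mulr_suml horner_sum; apply: eq_bigr => j _.
rewrite -big_split /= mulr_suml horner_sum; apply: eq_bigr => l _.
rewrite hornerZ cheb_cos !cos_df -mulrDr !mulrDr mulrN cosB cosD; by field.
Qed.

Lemma jackson_poly_ge0 q t : 0 <= (jackson_poly q).[cos t].
Proof.
rewrite jackson_poly_cos mulr_ge0 ?invr_ge0 ?mulr_ge0 ?(ltW NR) ?(ltW jackson_S_gt0)//.
by rewrite !addr_ge0// sqr_ge0.
Qed.

Lemma sum_cos_grid_int (m : nat) (b : bool) (c : R) : (m < N)%N ->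
  \sum_(q < N) cos ((-1) ^+ b * m%:R * phi q + c) = if m == 0%N then N%:R * cos c else 0.
Proof.
case: eqVneq => [->|m0] mN.
  under eq_bigr do rewrite mulr0 mul0r add0r.
  by rewrite sumr_const card_ord mulr_natl.
case: b; last first.
  by under eq_bigr do rewrite expr0 mul1r; rewrite sum_cos_grid// lt0n m0.
rewrite -[RHS](@sum_cos_grid m (- c)) ?lt0n ?m0//; apply: eq_bigr => q _.
by rewrite -cosN; congr cos; rewrite expr1; ring.
Qed.

(** Discrete orthogonality on the grid, valid because the index difference stays below [N]. The sign
    [s] covers both shifts that occur in [jackson_poly]. *)
Lemma sum_cos_diff_grid (j l : nat) (c s : R) (hs : s = 1 \/ s = -1) : (j < N)%N -> (l < N)%N ->
  \sum_(q < N) cos ((j%:R - l%:R) * (c + s * phi q)) = if j == l then N%:R else 0.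
Proof.
move=> jN lN.
have [b hb] : exists b : bool, s * (j%:R - l%:R) = (-1) ^+ b * (df j l)%:R.
  rewrite /df; have [jl|lj] := leqP j l.
    rewrite (eqP jl) add0n natrB//.
    case: hs => ->; [exists true|exists false]; rewrite ?expr1 ?expr0; ring.
  have /eqP -> : (l - j == 0)%N by rewrite subn_eq0 ltnW.
  rewrite addn0 (natrB _ (ltnW lj)).
  by case: hs => ->; [exists false|exists true]; rewrite ?expr1 ?expr0; ring.
have := @sum_cos_grid_int (df j l) b ((j%:R - l%:R) * c).
have -> : (df j l == 0)%N = (j == l) by rewrite /df; lia.
move=> h1; transitivity (if j == l then N%:R * cos ((j%:R - l%:R) * c) else 0).
  rewrite -h1; last by rewrite /df; lia.
  apply: eq_bigr => q _; congr cos; rewrite -hb; ring.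
by case: eqVneq => // ->; rewrite subrr mul0r cos0 mulr1.
Qed.

Lemma sum_kernel_grid (c s : R) (hs : s = 1 \/ s = -1) :
  \sum_(q < N) K (c + s * phi q) = N%:R * S.
Proof.
under eq_bigr do rewrite jackson_kernelE.
rewrite exchange_big /= mulr_sumr; apply: eq_bigr => j _.
rewrite exchange_big /= (bigD1 j)//= [X in _ + X]big1 ?addr0.
  rewrite -mulr_sumr sum_cos_diff_grid// ?eqxx; first by ring.
  1,2: by have := ltn_ord j; rewrite /N /M; lia.
move=> l lj; rewrite -mulr_sumr sum_cos_diff_grid//.
- by rewrite ifN ?mulr0// eq_sym.
- by have := ltn_ord j; rewrite /N /M; lia.
- by have := ltn_ord l; rewrite /N /M; lia.
Qed.

Lemma jackson_poly_sum t : \sum_(q < N) (jackson_poly q).[cos t] = 1.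
Proof.
under eq_bigr do rewrite jackson_poly_cos.
rewrite -mulr_sumr -mulr_suml big_split /=.
have h1 := @sum_kernel_grid t 1 (or_introl erefl).
have h2 := @sum_kernel_grid t (-1) (or_intror erefl).
under eq_bigr do rewrite -[phi _]mul1r.
rewrite h1; under eq_bigr do rewrite -mulN1r.
rewrite h2; field.
by rewrite (lt0r_neq0 NR) (lt0r_neq0 jackson_S_gt0).
Qed.

Lemma jackson_coef_top : a n.+1 = 0.
Proof. by rewrite /a /h mulrC divfK ?sinpi// lt0r_neq0 ?MR. Qed.

(* The a_j are the eigenvector of the path with eigenvalue 2 cos h. *)
Lemma jackson_neighbors : (\sum_(j < n.+1) a j * a j.+1) = cos h * S.
Proof.
have e : (\sum_(j < n.+1) a j * a j.+1) *+ 2 = cos h * S *+ 2; last by move: e; lra.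
rewrite /S mulr_sumr -!sumrMnl.
rewrite -(big_mkord xpredT (fun j => a j * a j.+1 *+ 2)) -(big_mkord xpredT (fun j => cos h * a j ^+ 2 *+ 2)).
apply/eqP; rewrite -subr_eq0 -sumrB; apply/eqP.
(* The difference of the two sides telescopes. Its boundary terms vanish, one by [a n.+1 = 0] and
   the other by [sin 0 = 0]. *)
rewrite (telescope_sumr_eq (fun j => a j * sin (j%:R * h)))//; last first.
  move=> j _ /=.
  have -> : a j.+1 = a j * cos h + cos (j.+1%:R * h) * sin h.
    by rewrite {1}/a -natr1 mulrDl mul1r sinD.
  have -> : sin (j%:R * h) = a j * cos h - cos (j.+1%:R * h) * sin h.
    by rewrite /a -sinB; congr sin; rewrite -natr1; ring.
  by rewrite -/(a j); ring.
by rewrite jackson_coef_top !mul0r sin0 mulr0 subr0.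
Qed.

(** Multiplication by the cosine shifts the index difference by one in either direction, so
    orthogonality retains exactly the products of neighbouring coefficients. *)
Lemma sum_kernel_cos_grid (c s : R) (hs : s = 1 \/ s = -1) :
  \sum_(q < N) K (c + s * phi q) * cos (c + s * phi q) = N%:R * (cos h * S).
Proof.
rewrite -jackson_neighbors.
transitivity ((\sum_(j < n.+1) \sum_(l < n.+1) a j * a l *
   (\sum_(q < N) cos ((j.+1%:R - l%:R) * (c + s * phi q)) + \sum_(q < N) cos ((j%:R - l.+1%:R) * (c + s * phi q)))) / 2).
  under eq_bigr do rewrite jackson_kernelE mulr_suml.
  rewrite exchange_big /= mulr_suml; apply: eq_bigr => j _.
  under eq_bigr do rewrite mulr_suml.
  rewrite exchange_big /= mulr_suml; apply: eq_bigr => l _.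
  rewrite -big_split /= mulr_sumr mulr_suml; apply: eq_bigr => q _.
  move: (c + s * phi q) => u.
  have -> : (j.+1%:R - l%:R) * u = (j%:R - l%:R) * u + u by rewrite -natr1; ring.
  have -> : (j%:R - l.+1%:R) * u = (j%:R - l%:R) * u - u by rewrite -natr1; ring.
  by rewrite cosD cosB; field.
have e1 (j l : 'I_n.+1) : \sum_(q < N) cos ((j.+1%:R - l%:R) * (c + s * phi q)) = if j.+1 == l then N%:R else 0.
  by apply: sum_cos_diff_grid => //; have := ltn_ord j; have := ltn_ord l; rewrite /N /M; lia.
have e2 (j l : 'I_n.+1) : \sum_(q < N) cos ((j%:R - l.+1%:R) * (c + s * phi q)) = if j == l.+1 :> nat then N%:R else 0.
  by apply: sum_cos_diff_grid => //; have := ltn_ord j; have := ltn_ord l; rewrite /N /M; lia.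
under eq_bigr => j _ do under eq_bigr => l _ do rewrite e1 e2 mulrDr.
under eq_bigr do rewrite big_split /=.
rewrite big_split /= [X in _ + X]exchange_big /=.
have e3 (j : 'I_n.+1) : \sum_(l < n.+1) a j * a l * (if j.+1 == l then N%:R else 0) = N%:R * (a j * a j.+1).
  have [jn|] := ltnP j.+1 n.+1.
    rewrite (bigD1 (Ordinal jn))//= eqxx big1 ?addr0; first by ring.
    move=> l lj; rewrite ifN ?mulr0//; apply: contra lj => /eqP jl; apply/eqP.
    by apply: val_inj => /=; rewrite jl.
  (* The last index has no right neighbour in the sum, which agrees with [a n.+1 = 0]. *)
  move=> jn; have -> : j.+1 = n.+1 by have := ltn_ord j; lia.
  rewrite jackson_coef_top !mulr0 big1// => l _.
  by rewrite ifN ?mulr0//; have := ltn_ord l; lia.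
under eq_bigr do rewrite e3.
under [X in _ + X]eq_bigr => l _.
  under eq_bigr => j _ do rewrite (mulrC (a j)) eq_sym.
  rewrite e3; over.
by rewrite -mulr_sumr; field.
Qed.

(** The square of [cos u - cos v] is at most the squared chord [2 (1 - cos (u - v))]. The kernel
    average of the latter is [2 (1 - cos h)], which is at most [h^2]. *)
Lemma jackson_poly_var t :
  \sum_(q < N) (jackson_poly q).[cos t] * (cos t - jackson_node q) ^+ 2 <= h ^+ 2.
Proof.
have hc : 2 * (1 - cos h) <= h ^+ 2.
  have -> : cos h = 1 - sin (h / 2) ^+ 2 *+ 2.
    have {1}-> : h = (h / 2) *+ 2 by rewrite -mulr_natr; field.
    by rewrite cos_mulr2n cos2sin2; ring.
  have h0 : 0 < h / 2 by rewrite !divr_gt0 ?pi_gt0 ?MR.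
  have h2 : h / 2 <= pi.
    rewrite /h ler_pdivrMr// ler_pdivrMr ?MR// -mulrA ler_peMr ?pi_ge0//.
    by rewrite -natrM ler1n.
  have := sin_le_id (ltW h0).
  have : 0 <= sin (h / 2) by rewrite sin_ge0_pi// (ltW h0).
  nra.
apply: le_trans hc.
have NS : 0 < N%:R * S by rewrite mulr_gt0 ?NR ?jackson_S_gt0.
pose V s := \sum_(q < N) K (t + s * phi q) * (2 * (1 - cos (t + s * phi q))).
have hV s : s = 1 \/ s = -1 -> V s = N%:R * S * (2 * (1 - cos h)).
  move=> hs; rewrite /V.
  under eq_bigr => q _ do rewrite mulrCA mulrBr mulr1 mulrBr.
  rewrite sumrB -!mulr_sumr sum_kernel_grid// sum_kernel_cos_grid//; ring.
have -> : 2 * (1 - cos h) = (N%:R * S)^-1 * ((V 1 + V (-1)) / 2).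
  by rewrite !hV; [|by right|by left]; field; rewrite (lt0r_neq0 NR) (lt0r_neq0 jackson_S_gt0).
rewrite /V -big_split /= mulr_suml mulr_sumr; apply: ler_sum => q _.
rewrite jackson_poly_cos -!mulrA ler_pM2l ?invr_gt0// mul1r mulN1r.
have K0 u : 0 <= K u by rewrite addr_ge0 ?sqr_ge0.
suff H (u v : R) : (cos u - cos v) ^+ 2 <= 2 * (1 - cos (u - v)).
  have h1 := H t (phi q); have h2 := H t (- phi q); rewrite opprK cosN in h2.
  have := ler_wpM2l (K0 (t + phi q)) h2; have := ler_wpM2l (K0 (t - phi q)) h1.
  rewrite /jackson_node; lra.
rewrite cosB; have := cos2Dsin2 u; have := cos2Dsin2 v.
by have := sqr_ge0 (sin u - sin v); nra.
Qed.

End Jackson.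

(** * Multivariate Jackson approximation on the cube *)

Section TensorPoly.
Variables (R : realType) (d k : nat).
Implicit Types (x y : d.-tuple R).

Definition polyfun (c : d.-tuple 'I_k.+1 -> R) x : R :=
  \sum_(a : d.-tuple 'I_k.+1 | (mdeg a <= k)%N) c a * monom a x.

Lemma ffun_tuple_bij (T : finType) :
  bijective (fun a : d.-tuple T => [ffun i => tnth a i] : {ffun 'I_d -> T}).
Proof.
exists (fun f : {ffun 'I_d -> T} => [tuple f i | i < d]).
  by move=> a; apply: eq_from_tnth => i; rewrite tnth_mktuple ffunE.
by move=> f; apply/ffunP => i; rewrite ffunE tnth_mktuple.
Qed.

Lemma prod_sum_tuple (T : finType) (F : 'I_d -> T -> R) :
  \prod_(i < d) \sum_(j : T) F i j = \sum_(a : d.-tuple T) \prod_(i < d) F i (tnth a i).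
Proof.
rewrite bigA_distr_bigA (reindex _ (onW_bij _ (ffun_tuple_bij T))) /=.
by apply: eq_bigr => a _; apply: eq_bigr => i _; rewrite ffunE.
Qed.

Lemma prod_horner_polyfun (n : nat) (P : 'I_d -> {poly R}) :
  (d * n <= k)%N -> (forall i, (size (P i) <= n.+1)%N) ->
  exists c, forall x, \prod_(i < d) (P i).[tnth x i] = polyfun c x.
Proof.
move=> dnk sP; exists (fun a : d.-tuple 'I_k.+1 => \prod_(i < d) (P i)`_(tnth a i)) => x.
have e (i : 'I_d) : (P i).[tnth x i] = \sum_(j < k.+1) (P i)`_j * tnth x i ^+ j.
  apply: horner_coef_wide; rewrite (leq_trans (sP i))// ltnS (leq_trans _ dnk)//.
  by rewrite leq_pmull// (leq_ltn_trans _ (ltn_ord i)).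
under eq_bigr do rewrite e.
rewrite prod_sum_tuple /polyfun [RHS]big_mkcond /=; apply: eq_bigr => a _.
rewrite big_split /=; case: ifPn => // am.
rewrite -/(monom a x).
(* Since [d n <= k], a multi-index of total degree above [k] has an entry above [n], where the
   coefficient of [P i] vanishes. *)
have [i hi] : exists i : 'I_d, (n < tnth a i)%N.
  apply/existsP; apply: contraNT am; rewrite negb_exists => /forallP h.
  rewrite /mdeg (leq_trans _ dnk)// -[d in (d * n)%N]card_ord -sum_nat_const.
  by apply: leq_sum => i _; rewrite leqNgt.
by rewrite (bigD1 i)//= nth_default ?mul0r ?(leq_trans (sP i)).
Qed.

Lemma enorm_le_l1 x y : enorm (tsub x y) <= \sum_(i < d) `|tnth x i - tnth y i|.
Proof.
have s0 : 0 <= \sum_(i < d) `|tnth x i - tnth y i| by exact: sumr_ge0.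
rewrite -[leRHS]ger0_norm// -sqrtr_sqr; apply: ler_wsqrtr.
rewrite expr2 mulr_suml; apply: ler_sum => i _.
rewrite mulr_sumr (bigD1 i)//= tnth_mktuple -expr2 real_normK ?num_real// lerDl.
by apply: sumr_ge0 => j _; rewrite mulr_ge0.
Qed.

End TensorPoly.

Section JacksonMulti.
Variables (R : realType) (d k : nat).
Hypotheses (d_gt0 : (0 < d)%N) (k_gt0 : (0 < k)%N).
Implicit Types (x y : d.-tuple R).

(** The inequality [|g| <= g^2 / (2h) + h / 2] passes from the second moment to the first without
    losing a constant. *)
Lemma jackson_abs (n : nat) (t : R) :
  \sum_(q < n.+2.*2) (jackson_poly R n q).[cos t] * `|cos t - jackson_node R n q| <= pi / n.+2%:R.
Proof.
set h : R := pi / n.+2%:R.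
have h0 : 0 < h by rewrite divr_gt0 ?pi_gt0.
apply: (@le_trans _ _ (\sum_(q < n.+2.*2) ((jackson_poly R n q).[cos t] * (cos t - jackson_node R n q) ^+ 2 / (2 * h)
   + (jackson_poly R n q).[cos t] * (h / 2)))).
  apply: ler_sum => q _.
  have := jackson_poly_ge0 n q t; set L := (_).[_] => L0.
  set g := cos t - _.
  rewrite -mulrA -mulrDr ler_wpM2l//.
  rewrite -subr_ge0 -[g ^+ 2]real_normK ?num_real//.
  have -> : `|g| ^+ 2 / (2 * h) + h / 2 - `|g| = (`|g| - h) ^+ 2 / (2 * h) by field; rewrite lt0r_neq0.
  by rewrite divr_ge0 ?sqr_ge0// mulr_ge0// ltW.
rewrite big_split /= -!mulr_suml jackson_poly_sum mul1r.
have := jackson_poly_var n t; rewrite -/h => hv.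
have e : h = h ^+ 2 / (2 * h) + h / 2 by field; rewrite lt0r_neq0.
rewrite [leRHS]e.
by rewrite lerD2r ler_wpM2r// invr_ge0 mulr_ge0// ltW.
Qed.

(** The approximant averages the values of [v] at tensor nodes, with nonnegative weights of sum 1.
    The error is at most the mean distance to the nodes, and the l1 norm splits this distance into
    one-dimensional errors. *)
Lemma jackson_multi (r : R) (v : d.-tuple R -> R) : 0 < r ->
  (forall x y, cube r x -> cube r y -> `|v x - v y| <= enorm (tsub x y)) ->
  exists c : d.-tuple 'I_k.+1 -> R, forall x, cube r x ->
    `|v x - polyfun c x| <= (d ^ 2)%:R * pi * r / k%:R.
Proof.
move=> r0 hv.
(* Degree [n] in each of the [d] coordinates keeps the total degree at most [k]. *)
pose n := (k %/ d)%N; pose N := n.+2.*2.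
have rn0 := lt0r_neq0 r0.
pose L (q : 'I_N) : {poly R} := jackson_poly R n q \Po (r^-1 *: 'X).
have sL q : (size (L q) <= n.+1)%N.
  rewrite (leq_trans (size_comp_poly_leq _ _))// ltnS.
  have sX : (size (r^-1 *: 'X : {poly R})).-1 = 1%N by rewrite size_scale ?size_polyX// invr_neq0.
  rewrite sX muln1.
  by have := size_jackson_poly R n q; lia.
have LE q u : (L q).[u] = (jackson_poly R n q).[u / r].
  by rewrite horner_comp; congr (_.[_]); rewrite hornerZ hornerX mulrC.
pose nd (q : d.-tuple 'I_N) : d.-tuple R := [tuple r * jackson_node R n (tnth q i) | i < d].
have ndc q : cube r (nd q).
  move=> i; rewrite tnth_mktuple -ler_norml normrM gtr0_norm//.
  by rewrite ger_pMr// cos_max.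
have dn : (d * n <= k)%N by rewrite mulnC leq_trunc_div.
have /choice[C hC] : forall q : d.-tuple 'I_N, exists c, forall x,
    \prod_(i < d) (L (tnth q i)).[tnth x i] = polyfun (k := k) c x.
  by move=> q; exact: (prod_horner_polyfun dn (fun i => sL (tnth q i))).
exists (fun a => \sum_(q : d.-tuple 'I_N) v (nd q) * C q a) => x hx.
have -> : polyfun (fun a => \sum_(q : d.-tuple 'I_N) v (nd q) * C q a) x =
    \sum_(q : d.-tuple 'I_N) v (nd q) * \prod_(i < d) (L (tnth q i)).[tnth x i].
  rewrite /polyfun; under eq_bigr do rewrite mulr_suml.
  rewrite exchange_big /=; apply: eq_bigr => q _.
  by rewrite hC /polyfun mulr_sumr; apply: eq_bigr => a _; rewrite mulrA.
pose t i := acos (tnth x i / r).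
have ht i : cos (t i) = tnth x i / r.
  apply: acosK; rewrite in_itv /=; have := hx i.
  by rewrite ler_pdivlMr// ler_pdivrMr// mul1r mulN1r.
pose l i q : R := (jackson_poly R n q).[cos (t i)].
have lE i (q : 'I_N) : (L q).[tnth x i] = l i q by rewrite LE /l ht.
have l1 i : \sum_(q < N) l i q = 1 by exact: jackson_poly_sum.
have l0 i q : 0 <= l i q by exact: jackson_poly_ge0.
pose W (q : d.-tuple 'I_N) := \prod_(i < d) l i (tnth q i).
have W0 q : 0 <= W q by apply: prodr_ge0.
have W1 : \sum_q W q = 1.
  by rewrite /W -(prod_sum_tuple (fun i (q : 'I_N) => l i q)) big1.
have -> : v x - \sum_(q : d.-tuple 'I_N) v (nd q) * \prod_(i < d) (L (tnth q i)).[tnth x i] =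
   \sum_(q : d.-tuple 'I_N) (v x - v (nd q)) * W q.
  rewrite {1}(_ : v x = \sum_q v x * W q); last by rewrite -mulr_sumr W1 mulr1.
  rewrite -sumrB; apply: eq_bigr => q _.
  rewrite mulrBl; congr (_ - _ * _); apply: eq_bigr => i _; exact: lE.
apply: (@le_trans _ _ (\sum_(q : d.-tuple 'I_N) \sum_(i < d) (r * `|cos (t i) - jackson_node R n (tnth q i)|) * W q)).
  apply: le_trans (ler_norm_sum _ _ _) _; apply: ler_sum => q _.
  rewrite normrM (ger0_norm (W0 q)) -mulr_suml ler_wpM2r//.
  apply: le_trans (hv _ _ hx (ndc q)) _; apply: le_trans (enorm_le_l1 _ _) _.
  apply: ler_sum => i _; rewrite tnth_mktuple ht.
  have -> : tnth x i - r * jackson_node R n (tnth q i) = r * (tnth x i / r - jackson_node R n (tnth q i)) by field.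
  by rewrite normrM gtr0_norm.
rewrite exchange_big /=.
have step (i : 'I_d) : \sum_(q : d.-tuple 'I_N) r * `|cos (t i) - jackson_node R n (tnth q i)| * W q
   <= r * (pi / n.+2%:R).
  under eq_bigr do rewrite -mulrA; rewrite -mulr_sumr ler_pM2l//.
  (* The distance is attached to the factor of coordinate [i] alone. The sum over tuples then
     factors, and every other factor sums to 1. *)
  pose F j (q : 'I_N) := l j q * (if j == i then `|cos (t i) - jackson_node R n q| else 1).
  have -> : \sum_(q : d.-tuple 'I_N) `|cos (t i) - jackson_node R n (tnth q i)| * W q =
     \sum_(q : d.-tuple 'I_N) \prod_(j < d) F j (tnth q j).
    apply: eq_bigr => q _; rewrite /F big_split /= mulrC; congr (_ * _).
    by rewrite (bigD1 i)//= eqxx big1 ?mulr1// => j /negPf ->.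
  rewrite -prod_sum_tuple (bigD1 i)//= [X in _ * X]big1; last first.
    by move=> j /negPf ji; rewrite /F ji; under eq_bigr do rewrite mulr1.
  by rewrite mulr1 /F eqxx; exact: jackson_abs.
apply: le_trans (ler_sum _ (fun i _ => step i)) _.
rewrite sumr_const card_ord -[leLHS]mulr_natl.
have -> : (d ^ 2)%:R * pi * r / k%:R = d%:R * (r * (pi * (d%:R / k%:R))) :> R.
  by rewrite natrX; field; rewrite lt0r_neq0// ltr0n.
rewrite ler_wpM2l// ler_pM2l// ler_pM2l ?pi_gt0//.
(* What remains is [k <= d (n + 2)], which follows from [n] being the quotient of [k] by [d]. *)
rewrite ler_pdivlMr ?ltr0n// mulrC ler_pdivrMr ?ltr0n// -natrM ler_nat.
have := ltn_ceil k d_gt0; rewrite -/n; nia.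
Qed.

End JacksonMulti.

(** * Finite signed measures *)

Lemma max_sub (R : realDomainType) (c : R) : Num.max c 0 - Num.max (- c) 0 = c.
Proof.
have [c0|c0] := leP 0 c; first by rewrite max_r ?subr0// oppr_le0.
by rewrite max_l ?sub0r ?opprK// oppr_ge0 ltW.
Qed.

Section FiniteMeasure.
Context (dT : measure_display) (T : measurableType dT) (R : realType).
Implicit Types (mu nu : {finite_measure set T -> \bar R}) (D A : set T) (f : T -> R).

Lemma bounded_integrable mu D f (M : R) : measurable D -> measurable_fun D f ->
  (forall x, D x -> `|f x| <= M) -> mu.-integrable D (EFin \o f).
Proof.
move=> mD mf fM; apply: measurable_bounded_integrable => //.
  by rewrite -ge0_fin_numE// fin_num_measure.
exists M; split; first by rewrite num_real.
by move=> N MN x Dx /=; exact: le_trans (fM x Dx) (ltW MN).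
Qed.

(** The measures are compared only inside [D], so both are restricted to [D] before monotonicity in
    the measure is applied. *)
Lemma Rintegral_le_measure mu nu D f : measurable D ->
  (forall A, measurable A -> A `<=` D -> (mu A <= nu A)%E) ->
  mu.-integrable D (EFin \o f) -> nu.-integrable D (EFin \o f) ->
  (forall x, D x -> 0 <= f x) ->
  \int[mu]_(x in D) f x <= \int[nu]_(x in D) f x.
Proof.
move=> mD munu i1 i2 f0.
rewrite /Rintegral fine_le ?integrable_fin_num//.
have e (m : {measure set T -> \bar R}) :
    (\int[m]_(x in D) (f x)%:E = \int[mrestr m mD]_x ((EFin \o f) \_ D) x)%E.
  rewrite -integral_mkcond.
  by apply: eq_measure_integral => A mA AD; rewrite /= /mrestr setIidl.
rewrite (e mu) (e nu); apply: ge0_le_measure_integral => //.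
- by move=> S mS; rewrite /= /mrestr munu//; exact: measurableI.
- move=> x; rewrite patchE; case: ifPn => //; rewrite inE => Dx.
  by rewrite /= lee_fin f0.
- by have /(measurable_restrictT _ mD) := measurable_int mu i1.
Qed.

Lemma Rintegral_eq_measure mu nu D f :
  (forall A, measurable A -> A `<=` D -> mu A = nu A) ->
  \int[mu]_(x in D) f x = \int[nu]_(x in D) f x.
Proof. by move=> h; rewrite /Rintegral (eq_measure_integral nu). Qed.

Definition add_dirac mu (c : {nonneg R}) (x : T) : set T -> \bar R :=
  measure_add mu (mscale c (dirac x)).

Section AddDirac.
Variables (mu : {finite_measure set T -> \bar R}) (c : {nonneg R}) (x : T).

HB.instance Definition _ := Measure.on (add_dirac mu c x).

Lemma add_diracE A : add_dirac mu c x A = (mu A + (c%:num * \1_A x)%:E)%E.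
Proof. by rewrite /add_dirac /= measure_addE /= /mscale/= diracE EFinM indicE. Qed.

Let add_dirac_fin : fin_num_fun (add_dirac mu c x).
Proof. by move=> A mA; rewrite add_diracE fin_numD fin_num_measure. Qed.

HB.instance Definition _ := Measure_isFinite.Build _ _ _ (add_dirac mu c x) add_dirac_fin.

Lemma Rintegral_add_dirac D f (M : R) : measurable D -> measurable_fun D f ->
  (forall y, D y -> `|f y| <= M) -> D x ->
  \int[add_dirac mu c x]_(y in D) f y = \int[mu]_(y in D) f y + c%:num * f x.
Proof.
move=> mD mf fM Dx.
have /measurable_EFinP mf' := mf.
have i2 : (\int[mscale c (dirac x)]_(y in D) (f y)%:E = (c%:num * f x)%:E)%E.
  rewrite integralE !ge0_integral_mscale//; last 2 first.
    exact: measurable_funeneg.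
    exact: measurable_funepos.
  rewrite !integral_dirac//; last 2 first.
    exact: measurable_funeneg.
    exact: measurable_funepos.
  rewrite diracE mem_set// !mul1e.
  by rewrite funeposE funenegE /= -!EFin_max -!EFinM -EFinB -mulrBr max_sub.
have h1 := bounded_integrable mu mD mf fM.
have h2 := bounded_integrable (mscale c (dirac x)) mD mf fM.
rewrite /Rintegral /add_dirac (integral_measure_add mD h1 h2) /= i2 fineD//.
exact: integrable_fin_num.
Qed.
End AddDirac.

Lemma Hahn_finite mu nu : exists P N, [/\ measurable P, measurable N, P `|` N = setT, P `&` N = set0 &
  (forall A, measurable A -> A `<=` P -> (nu A <= mu A)%E) /\
  (forall A, measurable A -> A `<=` N -> (mu A <= nu A)%E)].
Proof.
pose ch := cadd (charge_of_finite_measure mu) (cscale (-1) (charge_of_finite_measure nu)).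
have chE A : ch A = (mu A - nu A)%E.
  have -> : ch A = (mu A + (-1)%:E * nu A)%E by [].
  by rewrite EFinN mulN1e.
have [P [N [[mP hP] [mN hN] PNT PN0]]] := Hahn_decomposition ch.
exists P, N; split => //; split => A mA As.
- by have : (0 <= ch A)%E := hP A mA As; rewrite chE sube_ge0// fin_num_measure.
- by have : (ch A <= 0)%E := hN A mA As; rewrite chE sube_le0// fin_num_measure.
Qed.

End FiniteMeasure.

Section SgnMeasure.
Context (R : realType) (d : nat).
Local Notation pt := (d.-tuple R).
Implicit Types (u w : sgn_measure R d) (D A : set pt) (f g : pt -> R).

Lemma measurable_cube (r : R) : measurable (cube r : set pt).
Proof.
have -> : cube r = \bigcap_(i in [set: 'I_d]) ((@tnth d R)^~ i @^-1` `[- r, r]%classic).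
  apply/seteqP; split => x /= h i; first by move=> _; rewrite /= in_itv /=; exact: h.
  by have := h i I; rewrite /= in_itv.
apply: fin_bigcap_measurable => // i _; rewrite -[X in measurable X]setTI.
exact: (measurable_tnth i).
Qed.

Lemma fin_mu (m : {finite_measure set pt -> \bar R}) A : measurable A -> m A \is a fin_num.
Proof. exact: fin_num_measure. Qed.

Lemma tv_bounded u : has_ubound [set s | exists (n : nat) (A : 'I_n -> set pt),
        (forall i, measurable (A i)) /\
        (forall i j, i != j -> A i `&` A j = set0) /\
        s = \sum_(i < n) `| sm_val u (A i) | ].
Proof.
exists (fine (mu_plus u setT) + fine (mu_minus u setT)) => s [n [A [mA [dA ->]]]].
have H (m : {finite_measure set pt -> \bar R}) : \sum_(i < n) fine (m (A i)) <= fine (m setT).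
  rewrite -lee_fin -sumEFin fineK ?fin_mu//.
  under eq_bigr => i _ do rewrite fineK ?fin_mu//.
  rewrite -(measure_bigsetU_ord m predT)//; last first.
    by apply/trivIsetP => i j _ _; exact: dA.
  by apply: le_measure; rewrite ?inE//; exact: bigsetU_measurable.
apply: (@le_trans _ _ (\sum_(i < n) (fine (mu_plus u (A i)) + fine (mu_minus u (A i))))); last first.
  by rewrite big_split /= lerD.
apply: ler_sum => i _; rewrite (le_trans (ler_normB _ _))//.
by rewrite !ger0_norm// fine_ge0.
Qed.

Lemma le_tv_norm u n (A : 'I_n -> set pt) : (forall i, measurable (A i)) ->
  (forall i j, i != j -> A i `&` A j = set0) ->
  \sum_(i < n) `| sm_val u (A i) | <= tv_norm u.
Proof.
move=> mA dA; apply: ub_le_sup; first exact: tv_bounded.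
by exists n, A.
Qed.

Lemma tv_norm_le u (M : R) : (forall n (A : 'I_n -> set pt), (forall i, measurable (A i)) ->
  (forall i j, i != j -> A i `&` A j = set0) -> \sum_(i < n) `| sm_val u (A i) | <= M) ->
  tv_norm u <= M.
Proof.
move=> h; apply: ge_sup.
  exists 0, 0%N, (fun=> set0); split => //; split; first by move=> i j _; rewrite setI0.
  by rewrite big_ord0.
by move=> s [n [A [mA [dA ->]]]]; exact: h.
Qed.

(* Hahn decomposition: on the positive set, [M - f >= 0] and [mu_minus <= mu_plus]. *)
Lemma sm_int_le_tv u D f (M : R) : 0 <= M -> measurable D -> measurable_fun D f ->
  (forall x, D x -> `|f x| <= M) -> `|sm_int u D f| <= M * tv_norm u.
Proof.
move=> M0 mD mf fM.
have H (m1 m2 : {finite_measure set pt -> \bar R}) (E : set pt) : measurable E -> E `<=` D ->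
    (forall A, measurable A -> A `<=` E -> (m2 A <= m1 A)%E) ->
    `| \int[m1]_(x in E) f x - \int[m2]_(x in E) f x | <= M * `|fine (m1 E) - fine (m2 E)|.
  move=> mE ED m21.
  have mfE := measurable_funS mD ED mf.
  have fE x : E x -> `|f x| <= M by move=> /ED; exact: fM.
  have i m := bounded_integrable m mE mfE fE.
  have ic (m : {finite_measure set pt -> \bar R}) : m.-integrable E (EFin \o cst M).
    exact: finite_measure_integrable_cst.
  have key (s : R) : `|s| = 1 -> s * (\int[m1]_(x in E) f x - \int[m2]_(x in E) f x) <= M * (fine (m1 E) - fine (m2 E)).
    move=> s1.
    have is_ (m : {finite_measure set pt -> \bar R}) : m.-integrable E (EFin \o (fun x => s * f x)).
      by have := integrableZl mE s (i m).
    have iM (m : {finite_measure set pt -> \bar R}) : m.-integrable E (EFin \o (fun x => M - s * f x)).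
      by have := integrableB mE (ic m) (is_ m).
    have := Rintegral_le_measure mE m21 (iM m2) (iM m1).
    rewrite !(RintegralB mE (ic _) (is_ _)) !(RintegralZl s mE (i _)) !Rintegral_cst//.
    have h : forall x, E x -> 0 <= M - s * f x.
      by move=> x Ex; rewrite subr_ge0 (le_trans (ler_norm _))// normrM s1 mul1r fE.
    by move=> /(_ h); lra.
  rewrite [X in _ <= _ * X]ger0_norm; last first.
    by rewrite subr_ge0 fine_le ?fin_num_measure// m21.
  rewrite ler_norml -lerNl; apply/andP; split.
    by have := key (-1); rewrite normrN1 mulN1r; exact.
  by have := key 1; rewrite normr1 mul1r; exact.
have [P [N [mP mN PNT PN0 [hP hN]]]] := Hahn_finite (mu_plus u) (mu_minus u).
have i m := bounded_integrable m mD mf fM.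
have DE : D = (D `&` P) `|` (D `&` N) by rewrite -setIUr PNT setIT.
have mDP := measurableI _ _ mD mP; have mDN := measurableI _ _ mD mN.
have dPN : [disjoint D `&` P & D `&` N].
  by rewrite disj_set2E setIACA PN0 setI0.
have split_ (m : {finite_measure set pt -> \bar R}) : \int[m]_(x in D) f x = \int[m]_(x in D `&` P) f x + \int[m]_(x in D `&` N) f x.
  by have := @Rintegral_setU _ _ _ m _ _ f mDP mDN; rewrite -DE; apply => //; exact: i m.
have := @le_tv_norm u 2 (fun i => if i == 0 then D `&` P else D `&` N).
rewrite !big_ord_recl big_ord0 /= addr0 => tv.
have {}tv : `|sm_val u (D `&` P)| + `|sm_val u (D `&` N)| <= tv_norm u.
  apply: tv; first by move=> j; case: ifP.
  move=> a b; case: ifP => [/eqP ->|]; case: ifP => [/eqP ->|]//; rewrite ?eqxx//.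
  - by rewrite setIACA PN0 setI0.
  - by rewrite setIACA [N `&` P]setIC PN0 setI0.
  - by case: a b => [[|[|?]] ?] [[|[|?]] ?].
apply: le_trans (ler_wpM2l M0 tv); rewrite mulrDr /sm_int !split_.
have h1 := H (mu_plus u) (mu_minus u) _ mDP (@subIsetl _ _ _) (fun A mA AP => hP A mA (subset_trans AP (@subIsetr _ _ _))).
have h2 := H (mu_minus u) (mu_plus u) _ mDN (@subIsetl _ _ _) (fun A mA AP => hN A mA (subset_trans AP (@subIsetr _ _ _))).
rewrite [X in _ <= _ * X]distrC [X in X <= _]distrC in h2.
rewrite opprD addrACA; apply: le_trans (ler_normD _ _) _; exact: lerD h1 h2.
Qed.

Lemma sm_intD u D f g (Mf Mg : R) : measurable D -> measurable_fun D f -> measurable_fun D g ->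
  (forall x, D x -> `|f x| <= Mf) -> (forall x, D x -> `|g x| <= Mg) ->
  sm_int u D (fun x => f x + g x) = sm_int u D f + sm_int u D g.
Proof.
move=> mD mf mg fM gM; rewrite /sm_int.
have hf m := bounded_integrable m mD mf fM; have hg m := bounded_integrable m mD mg gM.
have e (m : {finite_measure set pt -> \bar R}) := RintegralD mD (hf m) (hg m).
by rewrite !e; ring.
Qed.

Lemma sm_intZ u D f (c M : R) : measurable D -> measurable_fun D f ->
  (forall x, D x -> `|f x| <= M) -> 
  sm_int u D (fun x => c * f x) = c * sm_int u D f.
Proof.
move=> mD mf fM; rewrite /sm_int.
have hf m := bounded_integrable m mD mf fM.
have e (m : {finite_measure set pt -> \bar R}) := RintegralZl c mD (hf m).
by rewrite !e; ring.
Qed.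


Lemma max0_ge0 (c : R) : 0 <= Num.max c 0. Proof. by rewrite le_max lexx orbT. Qed.

(** A signed point mass: the positive part of the weight goes to the first measure and the negative
    part to the second, so that both stay nonnegative. *)
Definition sm_add_dirac u (z : R * pt) : sgn_measure R d :=
  SgnMeasure (add_dirac (mu_plus u) (NngNum (max0_ge0 z.1)) z.2)
             (add_dirac (mu_minus u) (NngNum (max0_ge0 (- z.1))) z.2).


Lemma sm_val_add_dirac u z A : measurable A ->
  sm_val (sm_add_dirac u z) A = sm_val u A + z.1 * \1_A z.2.
Proof.
move=> mA; rewrite /sm_val /= !add_diracE !fineD ?fin_mu//=.
by rewrite -{3}(max_sub z.1); ring.
Qed.

Lemma sm_int_add_dirac u z D f (M : R) : measurable D -> measurable_fun D f ->
  (forall y, D y -> `|f y| <= M) -> D z.2 ->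
  sm_int (sm_add_dirac u z) D f = sm_int u D f + z.1 * f z.2.
Proof.
move=> mD mf fM Dz; rewrite /sm_int /= !(Rintegral_add_dirac _ _ mD mf fM Dz) /=.
by rewrite -{3}(max_sub z.1); ring.
Qed.

Definition sm_add_diracs u (s : seq (R * pt)) := foldr (fun z w => sm_add_dirac w z) u s.

Lemma sm_val_add_diracs u s A : measurable A ->
  sm_val (sm_add_diracs u s) A = sm_val u A + \sum_(z <- s) z.1 * \1_A z.2.
Proof.
move=> mA; elim: s => [|z s ih] /=; first by rewrite big_nil addr0.
by rewrite sm_val_add_dirac// ih big_cons -addrA [in RHS](addrC (z.1 * _)).
Qed.

Lemma sm_int_add_diracs u s D f (M : R) : measurable D -> measurable_fun D f ->
  (forall y, D y -> `|f y| <= M) -> (forall z, z \in s -> D z.2) ->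
  sm_int (sm_add_diracs u s) D f = sm_int u D f + \sum_(z <- s) z.1 * f z.2.
Proof.
move=> mD mf fM; elim: s => [|z s ih] /= Ds; first by rewrite big_nil addr0.
rewrite (sm_int_add_dirac _ mD mf fM); last by apply: Ds; rewrite mem_head.
rewrite ih; last by move=> w ws; apply: Ds; rewrite in_cons ws orbT.
by rewrite big_cons -addrA [in RHS](addrC (z.1 * _)).
Qed.

Lemma tv_norm_add_diracs u s :
  tv_norm (sm_add_diracs u s) <= tv_norm u + \sum_(z <- s) `|z.1|.
Proof.
apply: tv_norm_le => n A mA dA.
apply: (@le_trans _ _ (\sum_(i < n) (`|sm_val u (A i)| + \sum_(z <- s) `|z.1| * \1_(A i) z.2))).
  apply: ler_sum => i _; rewrite sm_val_add_diracs//.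
  apply: le_trans (ler_normD _ _) _; rewrite lerD2l.
  apply: le_trans (ler_norm_sum _ _ _) _; apply: ler_sum => z _.
  by rewrite normrM ler_wpM2l// ger0_norm// indicE.
rewrite big_split /= lerD ?le_tv_norm//.
rewrite exchange_big /=; apply: ler_sum => z _.
rewrite -mulr_sumr ler_piMr//.
(* By disjointness the point lies in at most one of the sets. *)
have [[i0 Ai0]|H] := pselect (exists i, A i z.2).
  rewrite (bigD1 i0)//= big1 ?addr0 ?indicE ?mem_set// => j ji.
  rewrite indicE memNset// => Aj.
  by have := dA _ _ ji; rewrite -subset0 => /(_ z.2); apply.
rewrite big1// => i _; rewrite indicE memNset// => Ai; apply: H; by exists i.
Qed.

Lemma vanishes_add_diracs u s D : (forall z, z \in s -> D z.2) ->
  vanishes_outside u D -> vanishes_outside (sm_add_diracs u s) D.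
Proof.
move=> Ds vu A mA AD; rewrite sm_val_add_diracs// vu// add0r big_seq big1// => z zs.
by rewrite indicE memNset ?mulr0// => /AD; apply; exact: Ds.
Qed.

(* Off [D] the two parts of [u] agree, but neither of them need vanish. *)
Lemma sm_int_setT u D f (M : R) : measurable D -> vanishes_outside u D ->
  measurable_fun setT f -> (forall y, `|f y| <= M) -> sm_int u setT f = sm_int u D f.
Proof.
move=> mD vu mf fM.
have mDC := measurableC mD.
have i m := bounded_integrable m measurableT mf (fun y _ => fM y).
have split_ (m : {finite_measure set pt -> \bar R}) :
   \int[m]_x f x = \int[m]_(x in D) f x + \int[m]_(x in ~` D) f x.
  have := @Rintegral_setU _ _ _ m _ _ f mD mDC; rewrite setUv; apply; first exact: i m.
  by rewrite disj_set2E setICr.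
rewrite /sm_int !split_ opprD addrACA.
suff -> : \int[mu_plus u]_(x in ~` D) f x = \int[mu_minus u]_(x in ~` D) f x by rewrite subrr addr0.
apply: Rintegral_eq_measure => A mA AD.
have := vu A mA AD; rewrite /sm_val => /eqP; rewrite subr_eq0 => /eqP h.
by rewrite -[LHS]fineK ?fin_mu// h fineK ?fin_mu.
Qed.

End SgnMeasure.

(** * Iterated Lebesgue integrals *)

Section FubiniLeb.
Context (dY : measure_display) (Y : measurableType dY) (R : realType).
Local Notation leb := (@lebesgue_measure R).
Implicit Types (m : {finite_measure set Y -> \bar R}).

Section Pair.
Variables (m : {finite_measure set Y -> \bar R}) (phi : R -> Y -> R).
Hypotheses (mphi : measurable_fun setT (fun z : R * Y => phi z.1 z.2))
  (bphi : forall t, exists B, forall y, `|phi t y| <= B)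
  (C : R) (iphi : forall y, leb.-integrable setT (EFin \o phi^~ y))
  (cphi : forall y, \int[leb]_t `|phi t y| <= C).

Lemma measurable_section1 t : measurable_fun setT (phi t).
Proof. exact: (measurableT_comp mphi (pair1_measurable t)). Qed.

(** The Lebesgue integrals of [|phi|] are bounded by [C] uniformly in [y] and [m] is finite, so
    Tonelli in this order gives a finite integral. *)
Lemma integrable_pair : (leb \x m)%E.-integrable setT (fun z : R * Y => (phi z.1 z.2)%:E).
Proof.
apply/(integrable21ltyP _ m); first exact/measurable_EFinP.
apply: (@le_lt_trans _ _ (\int[m]_y C%:E)%E).
  apply: ge0_le_integral => //.
  - by move=> y _; apply: integral_ge0.
  - have mabs : measurable_fun setT (abse \o (fun z : R * Y => (phi z.1 z.2)%:E)).
      by apply: measurableT_comp => //; exact/measurable_EFinP.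
    have h0 : forall z : R * Y, (0 <= (abse \o (fun z : R * Y => (phi z.1 z.2)%:E)) z)%E by move=> z; exact: abse_ge0.
    have := @measurable_fun_fubini_tonelli_G _ _ _ _ R leb _ mabs h0; exact.
  - move=> y _ /=.
    have iy := integrable_norm (iphi y).
    rewrite -[leLHS]fineK ?lee_fin; first exact: cphi.
    exact: (integrable_fin_num measurableT iy).
(* [C] is nonnegative because it bounds the integral of an absolute value at the default element
   [point]. *)
by rewrite integral_cst//= -ge0_fin_numE ?fin_numM ?fin_num_measure// mule_ge0//
  lee_fin (le_trans _ (cphi point))// Rintegral_ge0.
Qed.

Lemma integrable_section1 t : m.-integrable setT (EFin \o phi t).
Proof.
have [B hB] := bphi t.
exact: (bounded_integrable m measurableT (measurable_section1 t) (fun y _ => hB y)).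
Qed.

Lemma measurable_integral_leb : measurable_fun setT (fun y => \int[leb]_t phi t y).
Proof.
apply: (measurableT_comp (fine_measurable measurableT)) => //=.
exact: (measurable_fubini_G integrable_pair).
Qed.

Lemma integrable_integral_m : leb.-integrable setT (fun t => (\int[m]_y phi t y)%:E).
Proof.
apply: eq_integrable (integrable_fubini_F integrable_pair) => // t _.
by rewrite /fubini_F /Rintegral fineK//; exact: integrable_fin_num (integrable_section1 t).
Qed.

Lemma Rintegral_fubini : \int[leb]_t \int[m]_y phi t y = \int[m]_y \int[leb]_t phi t y.
Proof.
rewrite /Rintegral; congr fine.
have := Fubini integrable_pair => /= h.
transitivity (\int[leb]_x \int[m]_y (phi x y)%:E)%E.
  by apply: eq_integral => t _; rewrite fineK//; exact: integrable_fin_num (integrable_section1 t).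
rewrite h; apply: eq_integral => y _.
by rewrite fineK//; exact: integrable_fin_num (iphi y).
Qed.

End Pair.

(* The two measures are carried through the induction together because [leb_int]
   is only additive on functions all of whose partial integrals are integrable. *)
Lemma leb_int_fubini (m1 m2 : {finite_measure set Y -> \bar R}) n (h : Y -> R) (f : 'I_n -> R -> Y -> R) :
  measurable_fun setT h -> (exists H, forall y, `|h y| <= H) ->
  (forall i, measurable_fun setT (fun z : R * Y => f i z.1 z.2)) ->
  (forall i t, exists B, forall y, `|f i t y| <= B) ->
  (forall i y, leb.-integrable setT (EFin \o (f i)^~ y)) ->
  (forall i, exists C, forall y, \int[leb]_t `|f i t y| <= C) ->
  leb_int (fun x : n.-tuple R =>
    \int[m1]_y (h y * \prod_(i < n) f i (tnth x i) y) -
    \int[m2]_y (h y * \prod_(i < n) f i (tnth x i) y)) =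
  \int[m1]_y (h y * \prod_(i < n) \int[leb]_t f i t y) -
  \int[m2]_y (h y * \prod_(i < n) \int[leb]_t f i t y).
Proof.
elim: n h f => [|n ih] h f mh [H hH] mf bf If cf.
  by rewrite /=; congr (_ - _); apply: eq_Rintegral => y _; rewrite !big_ord0.
rewrite /=.
pose G y := \prod_(i < n) \int[leb]_t f (lift ord0 i) t y.
have [Cf hCf] := choice cf.
have Gb y : `|G y| <= \prod_(i < n) Cf (lift ord0 i).
  rewrite /G normr_prod; apply: ler_prod => i _; rewrite normr_ge0 /=.
  by apply: le_trans (hCf _ y); apply: le_normr_Rintegral.
have mG : measurable_fun setT G.
  rewrite /G; apply: measurable_prod => i _.
  exact: (measurable_integral_leb m1 (mf (lift ord0 i)) (If (lift ord0 i)) (hCf (lift ord0 i))).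
pose phi t y := h y * f ord0 t y * G y.
have mphi : measurable_fun setT (fun z : R * Y => phi z.1 z.2).
  apply: measurable_funM; last exact: measurableT_comp mG measurable_snd.
  by apply: measurable_funM => //; exact: measurableT_comp mh measurable_snd.
have bphi t : exists B, forall y, `|phi t y| <= B.
  have [B hB] := bf ord0 t.
  exists (H * B * \prod_(i < n) Cf (lift ord0 i)) => y.
  by rewrite /phi !normrM !ler_pM// mulr_ge0.
have phiE y t : phi t y = (h y * G y) * f ord0 t y by rewrite /phi; ring.
have iphi y : leb.-integrable setT (EFin \o phi^~ y).
  have := integrableZl measurableT (h y * G y) (If ord0 y).
  by apply: eq_integrable => // t _; rewrite /= phiE.
have cphi y : \int[leb]_t `|phi t y| <= H * (\prod_(i < n) Cf (lift ord0 i)) * Cf ord0.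
  under eq_Rintegral do rewrite phiE normrM.
  rewrite RintegralZl//; last exact: integrable_norm.
  by rewrite ler_pM// ?Rintegral_ge0// normrM ler_pM.
have fm (m : {finite_measure set Y -> \bar R}) := @Rintegral_fubini m phi mphi bphi _ iphi cphi.
have im (m : {finite_measure set Y -> \bar R}) := @integrable_integral_m m phi mphi bphi _ iphi cphi.
transitivity (\int[leb]_t (\int[m1]_y phi t y - \int[m2]_y phi t y)).
  apply: eq_Rintegral => t _.
  (* The first coordinate is frozen and its factor absorbed into the weight; this is why the
     statement carries a general [h]. *)
  have := ih (fun y => h y * f ord0 t y) (fun i => f (lift ord0 i)).
  rewrite -/G => <- //.
  - congr leb_int; apply/funext => x.
    congr (_ - _); apply: eq_Rintegral => y _.
      rewrite big_ord_recl tnth0 mulrA; congr (_ * _); apply: eq_bigr => i _.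
      by rewrite tnthS.
    rewrite big_ord_recl tnth0 mulrA; congr (_ * _); apply: eq_bigr => i _.
    by rewrite tnthS.
  - by apply: measurable_funM => //; exact: (measurable_section1 (mf ord0)).
  - have [B hB] := bf ord0 t; exists (H * B) => y.
    by rewrite normrM ler_pM.
rewrite (RintegralB measurableT (im m1) (im m2)) (fm m1) (fm m2); congr (_ - _); apply: eq_Rintegral => y _.
  under eq_Rintegral do rewrite phiE.
  by rewrite RintegralZl// big_ord_recl /G; ring.
under eq_Rintegral do rewrite phiE.
by rewrite RintegralZl// big_ord_recl /G; ring.
Qed.

End FubiniLeb.

(** * Gaussian moments *)

Section Moments.
Variable R : realType.
Local Notation leb := (@lebesgue_measure R).
Implicit Types (s t r : R).

Lemma exp_partial_sum_le n (x : R) : 0 <= x -> \sum_(j < n) x ^+ j / j`!%:R <= expR x.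
Proof.
move=> x0.
have -> : \sum_(j < n) x ^+ j / j`!%:R = series (exp_coeff x) n.
  by rewrite /series /= big_mkord.
apply: nondecreasing_cvgn_le; last exact: is_cvg_series_exp_coeff.
by apply/nondecreasing_series => i _ _; exact: exp_coeff_ge0.
Qed.

Lemma exprn_le_fact_expR a (x : R) : 0 <= x -> x ^+ a <= a`!%:R * expR x.
Proof.
move=> x0; rewrite mulrC -ler_pdivrMr ?ltr0n ?fact_gt0//.
apply: le_trans (exp_partial_sum_le a.+1 x0); rewrite big_ord_recr /= lerDr.
by apply: sumr_ge0 => j _; rewrite divr_ge0 ?exprn_ge0.
Qed.

Variable sg : R.
Hypothesis sg_gt0 : 0 < sg.
Let sg0 : sg != 0. Proof. exact: lt0r_neq0. Qed.

(** The power of [t] is bounded by a factorial times [expR (u + r)], and doubling the standard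
    deviation absorbs the linear exponent by completing a square. The prefactor depends on the mean
    only through [r]. *)
Lemma normal_fun_dominated a r s t : `|s| <= r ->
  `|t| ^+ a * normal_fun s sg t <= a`!%:R * expR (r + sg ^+ 2) * normal_fun s (2 * sg) t.
Proof.
move=> sr; set u := `|t - s|.
have tu : `|t| <= u + r.
  have -> : t = (t - s) + s by ring.
  by rewrite (le_trans (ler_normD _ _))// lerD2l.
have r0 : 0 <= r by apply: le_trans sr.
have ur0 : 0 <= u + r by rewrite addr_ge0// /u normr_ge0.
apply: (@le_trans _ _ (a`!%:R * expR (u + r) * normal_fun s sg t)).
  rewrite ler_wpM2r ?normal_fun_ge0//.
  by apply: le_trans (exprn_le_fact_expR a ur0); rewrite lerXn2r ?nnegrE.
rewrite -!mulrA ler_wpM2l//.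
rewrite /normal_fun -!expRD ler_expR.
have -> : (t - s) ^+ 2 = u ^+ 2 by rewrite real_normK ?num_real.
have s2 : 0 < sg ^+ 2 by rewrite exprn_gt0.
rewrite -subr_ge0.
have -> : r + sg ^+ 2 + - u ^+ 2 / ((2 * sg) ^+ 2 *+ 2) - (u + r + - u ^+ 2 / (sg ^+ 2 *+ 2)) =
  ((u - 4 / 3 * sg ^+ 2) ^+ 2 * (3 / 8) + sg ^+ 2 ^+ 2 / 3) / sg ^+ 2.
  by field.
apply: divr_ge0 (ltW s2); apply: addr_ge0; first by rewrite mulr_ge0 ?sqr_ge0.
by rewrite divr_ge0 ?sqr_ge0.
Qed.

Definition gmom_bound a r := a`!%:R * expR (r + sg ^+ 2) * normal_peak sg / normal_peak (2 * sg).

Lemma normal_pdf_dominated a r s t : `|s| <= r ->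
  `|t ^+ a * normal_pdf s sg t| <= gmom_bound a r * normal_pdf s (2 * sg) t.
Proof.
move=> sr; have sg2 : 2 * sg != 0 by rewrite mulf_neq0.
rewrite !normal_pdfE// !normrM normrX (ger0_norm (normal_peak_ge0 _)) (ger0_norm (normal_fun_ge0 _ _ _)).
rewrite mulrCA /gmom_bound.
have -> : a`!%:R * expR (r + sg ^+ 2) * normal_peak sg / normal_peak (2 * sg) * (normal_peak (2 * sg) * normal_fun s (2 * sg) t)
  = normal_peak sg * (a`!%:R * expR (r + sg ^+ 2) * normal_fun s (2 * sg) t).
  by field; rewrite lt0r_neq0// normal_peak_gt0.
by rewrite ler_wpM2l ?normal_peak_ge0// normal_fun_dominated.
Qed.

Lemma gmom_bound_ge0 a r : 0 <= gmom_bound a r.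
Proof. by rewrite divr_ge0 ?normal_peak_ge0// mulr_ge0 ?normal_peak_ge0// mulr_ge0// expR_ge0. Qed.

Lemma measurable_gmom a s : measurable_fun setT (fun t => t ^+ a * normal_pdf s sg t).
Proof. by apply: measurable_funM; [exact: measurable_funX|exact: measurable_normal_pdf]. Qed.

Lemma integrable_gmom a s : leb.-integrable setT (EFin \o (fun t => t ^+ a * normal_pdf s sg t)).
Proof.
have i2 := integrableZl measurableT (gmom_bound a `|s|) (integrable_normal_pdf s (2 * sg)).
apply: le_integrable i2 => //; first by apply/measurable_EFinP; exact: measurable_gmom.
move=> t _ /=; rewrite lee_fin (le_trans (normal_pdf_dominated _ _ (lexx _)))//.
by rewrite ler_norm.
Qed.

Lemma gmom_abs_le a r s : `|s| <= r ->
  \int[leb]_t `|t ^+ a * normal_pdf s sg t| <= gmom_bound a r.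
Proof.
move=> sr.
have i2 := integrableZl measurableT (gmom_bound a r) (integrable_normal_pdf s (2 * sg)).
apply: (@le_trans _ _ (\int[leb]_t (gmom_bound a r * normal_pdf s (2 * sg) t))).
  apply: le_Rintegral => //; first exact: integrable_norm (integrable_gmom a s).
  by move=> t _; exact: normal_pdf_dominated.
rewrite RintegralZl//; last exact: integrable_normal_pdf.
by rewrite /Rintegral integral_normal_pdf /= mulr1.
Qed.

(** On a symmetric interval the integral is a difference of boundary values of [F], which decay like
    the inverse of the length because [t F t] is bounded. Dominated convergence passes to the whole
    line. *)
Lemma Rintegral_derive_eq0 (f F : R -> R) (B : R) :
  (forall t, is_derive t 1 F (f t)) -> continuous f ->
  leb.-integrable setT (EFin \o f) -> (forall t, `|t * F t| <= B) ->
  \int[leb]_t f t = 0.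
Proof.
move=> dF cf intf FB.
have cF : continuous F.
  by move=> t; apply: differentiable_continuous; apply/derivable1_diffP; exact: ex_derive.
pose I (n : nat) : set R := `[- n.+1%:R, n.+1%:R]%classic.
have IE n : \int[leb]_(t in I n) f t = F n.+1%:R - F (- n.+1%:R).
  rewrite /Rintegral /I (@continuous_FTC2 _ f F) ?EFinB//.
  - by rewrite (@lt_trans _ _ 0)// ?oppr_lt0.
  - exact: continuous_subspaceT.
  - split; first by move=> x _; exact: ex_derive.
    + by apply: cvg_at_right_filter; exact: cF.
    + by apply: cvg_at_left_filter; exact: cF.
  - by move=> x _; rewrite derive1E; exact: derive_val.
have c0 : (\int[leb]_(t in I n) f t) @[n --> \oo] --> 0.
  have hb n : `|\int[leb]_(t in I n) f t| <= (2 * B) * n.+1%:R^-1.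
    rewrite IE -ler_pdivrMr// invrK.
    have h1 := FB n.+1%:R; have h2 := FB (- n.+1%:R).
    rewrite normrM normr_nat in h1; rewrite normrM normrN normr_nat in h2.
    apply: (@le_trans _ _ ((`|F n.+1%:R| + `|F (- n.+1%:R)|) * n.+1%:R)).
      by rewrite ler_wpM2r// ler_normB.
    rewrite mulrDl; lra.
  apply/norm_cvg0P.
  apply: (@squeeze_cvgr _ _ _ _ (fun=> 0) (fun n => (2 * B) * n.+1%:R^-1)).
  - by near=> n; rewrite normr_ge0 hb.
  - exact: cvg_cst.
  - rewrite -[X in _ --> X](mulr0 (2 * B)); apply: cvgM; first exact: cvg_cst.
    exact: cvg_harmonic.
have mI n : measurable (I n) by exact: measurable_itv.
have mf : measurable_fun setT f by apply/measurable_EFinP; exact: measurable_int intf.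
have pw t : setT t -> (EFin \o (f \_ (I n))) t @[n --> \oo] --> (EFin \o f) t.
  move=> _; apply: cvg_near_cst; near=> n; rewrite /= patchE mem_set//.
  rewrite /I /= in_itv /= -ler_norml.
  apply: (@le_trans _ _ n%:R); last by rewrite ler_nat.
  by near: n; exact: nbhs_infty_ger.
have H1 n : measurable_fun setT (EFin \o (f \_ (I n))).
  apply/measurable_EFinP; apply/(measurable_restrictT _ (mI n)); exact: measurable_funS mf.
have H2 : measurable_fun setT (EFin \o f) by apply/measurable_EFinP.
have H3 : {ae leb, forall t, setT t -> (fun n => (EFin \o (f \_ (I n))) t) @ \oo --> (EFin \o f) t}.
  by apply: aeW => t Tt; exact: pw.
have H4 : leb.-integrable setT (EFin \o (fun t => `|f t|)) by exact: integrable_norm intf.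
have [_ _ dc] := @dominated_convergence _ _ _ leb setT measurableT _ _ _ H1 H2 H3 H4 ltac:(by apply: aeW => t n _; rewrite /= lee_fin patchE; case: ifP => //; rewrite normr0).
have c1 : (\int[leb]_(t in I n) f t) @[n --> \oo] --> \int[leb]_t f t.
  have fi n : (\int[leb]_x ((EFin \o (f \_ (I n))) x) = (\int[leb]_(t in I n) f t)%:E)%E.
    have ii : leb.-integrable (I n) (EFin \o f).
      by apply: (@integrableS _ _ _ leb setT) => //; exact: measurable_itv.
    have ff : (\int[leb]_(t in I n) (f t)%:E)%E \is a fin_num by apply: integrable_fin_num ii; exact: measurable_itv.
    rewrite /Rintegral fineK//.
    by rewrite [RHS]integral_mkcond; apply: eq_integral => t _; rewrite restrict_EFin.
  have fT : (\int[leb]_x ((EFin \o f) x) = (\int[leb]_t f t)%:E)%E.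
    by rewrite /Rintegral fineK//; exact: (integrable_fin_num measurableT intf).
  move: dc; rewrite fT; under eq_fun do rewrite fi.
  by move/fine_cvg.
by apply: cvg_unique c1 c0.
Unshelve. all: by end_near.
Qed.

Definition gmom a s := \int[leb]_t (t ^+ a * normal_pdf s sg t).

Lemma gmom0 s : gmom 0 s = 1.
Proof.
rewrite /gmom; under eq_Rintegral do rewrite expr0 mul1r.
by rewrite /Rintegral integral_normal_pdf.
Qed.

Lemma is_derive_normal_pdf s t :
  is_derive t 1 (normal_pdf s sg) (- (t - s) / sg ^+ 2 * normal_pdf s sg t).
Proof.
rewrite normal_pdfE//.
have h1 : is_derive t (1:R) (fun x : R => - (x - s) ^+ 2 / (sg ^+ 2 *+ 2)) (- (t - s) / sg ^+ 2).
  pose q : {poly R} := (- (sg ^+ 2 *+ 2)^-1) *: ('X - s%:P) ^+ 2.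
  have -> : (fun x : R => - (x - s) ^+ 2 / (sg ^+ 2 *+ 2)) = horner q.
    by apply/funext => x; rewrite /q hornerZ horner_exp hornerXsubC; field.
  have -> : - (t - s) / sg ^+ 2 = q^`().[t].
    rewrite /q derivZ expr2 derivM derivB derivX derivC subr0 !hornerE /=; field => //.
  exact: is_derive_poly.
have h2 := is_derive1_comp (is_derive_expR _) h1.
have h3 := is_deriveZ (normal_peak sg) h2.
apply: (is_derive_eq h3); rewrite /GRing.scale /= /normal_fun; ring.
Qed.

(** Integration by parts: the derivative of [t^a] times the density has zero integral. For [a = 0]
    the truncated index [a.-1] is harmless, its coefficient being 0. *)
Lemma gmom_rec a s : gmom a.+1 s = s * gmom a s + a%:R * sg ^+ 2 * gmom a.-1 s.
Proof.
pose p := normal_pdf s sg.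
pose f t := a%:R * (t ^+ a.-1 * p t) + (s / sg ^+ 2 * (t ^+ a * p t) - (sg ^+ 2)^-1 * (t ^+ a.+1 * p t)).
have I0 := integrableZl measurableT a%:R (integrable_gmom a.-1 s).
have I1 := integrableZl measurableT (s / sg ^+ 2) (integrable_gmom a s).
have I2 := integrableZl measurableT (sg ^+ 2)^-1 (integrable_gmom a.+1 s).
have I12 := integrableB measurableT I1 I2.
have If := integrableD measurableT I0 I12.
have : \int[leb]_t f t = 0.
  apply: (@Rintegral_derive_eq0 f (fun t => t ^+ a * p t) (gmom_bound a.+1 `|s| * normal_peak (2 * sg))).
  - move=> t.
    have h := is_deriveM (is_derive_poly 'X^a t) (is_derive_normal_pdf s t).
    have -> : (fun t : R => t ^+ a * p t) = (horner 'X^a : R -> R) * p.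
      by apply/funext => x; rewrite -[RHS]/('X^a.[x] * p x) hornerXn.
    apply: (is_derive_eq h).
    rewrite derivXn hornerMn !hornerXn /f /GRing.scale /= -/(p t) [t ^+ a.+1]exprS -mulr_natl; field => //.
  - have cp : continuous p by exact: continuous_normal_pdf.
    have cX (n : nat) : continuous (fun t : R => t ^+ n) by move=> t; exact: exprn_continuous.
    move=> t; rewrite /f.
    apply: cvgD; first by apply: cvgM; [exact: cvg_cst|apply: cvgM; [exact: cX|exact: cp]].
    apply: cvgB; (apply: cvgM; [exact: cvg_cst|apply: cvgM; [exact: cX|exact: cp]]).
  - exact: If.
  - move=> t; rewrite mulrA -exprS (le_trans (normal_pdf_dominated _ _ (lexx _)))//.
    by rewrite ler_wpM2l ?gmom_bound_ge0// normal_pdf_ub// mulf_neq0.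
rewrite /f RintegralD// RintegralB// !RintegralZl//; try exact: integrable_gmom.
rewrite -!/(gmom _ _) => h.
have s2 : sg ^+ 2 != 0 by rewrite expf_neq0.
have -> : gmom a.+1 s = sg ^+ 2 * ((sg ^+ 2)^-1 * gmom a.+1 s) by field.
have -> : (sg ^+ 2)^-1 * gmom a.+1 s = a%:R * gmom a.-1 s + s / sg ^+ 2 * gmom a s by lra.
by field.
Qed.

End Moments.

(** * Heat polynomials and the matrix exponential *)

Section HeatPoly.
Variable R : realType.
Implicit Types (s : R).

Fixpoint heat_poly2 s (n : nat) : {poly R} * {poly R} :=
  if n is m.+1 then
    let: (p, q) := heat_poly2 s m in (q, s *: q + (2 * m.+1)%:R *: ('X * p))
  else (1, s%:P).

(* The heat polynomial: the [n]-th moment about 0 of a heat kernel centred at [s],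
   as a polynomial in the time variable. *)
Definition heat_poly n s := (heat_poly2 s n).1.

Lemma heat_poly0 s : heat_poly 0 s = 1. Proof. by []. Qed.
Lemma heat_poly1 s : heat_poly 1 s = s%:P. Proof. by []. Qed.
Lemma heat_polySS n s : heat_poly n.+2 s =
  s *: heat_poly n.+1 s + (2 * n.+1)%:R *: ('X * heat_poly n s).
Proof. by rewrite /heat_poly /=; case: (heat_poly2 s n). Qed.

(** The one-dimensional form of the action of [A], by induction along the recurrence. For [n <= 1]
    the truncated index [n.-2] comes with coefficient 0. *)
Lemma deriv_heat_poly n s : (heat_poly n s)^`() = (n * n.-1)%:R *: heat_poly n.-2 s.
Proof.
elim/nat_ind2: n => [||n ih0 ih1].
- by rewrite heat_poly0 -polyC1 derivC scale0r.
- by rewrite heat_poly1 derivC scale0r.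
- rewrite heat_polySS derivD !derivZ derivM derivX mul1r ih0 ih1 /=.
  case: n {ih0 ih1} => [|n] /=.
    by rewrite heat_poly0 !mul0n scale0r scaler0 add0r mulr0 addr0.
  case: n => [|n] /=.
    rewrite heat_poly0 heat_poly1 muln0 scale0r mulr0 addr0.
    rewrite -!mul_polyC; ring.
  rewrite heat_polySS -!mul_polyC; ring.
Qed.

Lemma heat_poly_at0 n s : (heat_poly n s).[0] = s ^+ n.
Proof.
elim/nat_ind2: n => [||n ih0 ih1]; rewrite ?heat_poly0 ?heat_poly1 ?hornerC ?hornerE//.
by rewrite heat_polySS hornerD !hornerZ hornerM hornerX ih1 mul0r mulr0 addr0 [RHS]exprS.
Qed.

(** The variance of the heat kernel is twice the time, hence the evaluation at [sg ^+ 2 / 2]. *)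
Lemma gmom_heat_poly (sg : R) n s : 0 < sg -> gmom sg n s = (heat_poly n s).[sg ^+ 2 / 2].
Proof.
move=> sg0; elim/nat_ind2: n => [||n ih0 ih1].
- by rewrite heat_poly0 hornerC gmom0.
- by rewrite heat_poly1 hornerC gmom_rec// gmom0 mulr1 mul0r mul0r addr0.
- rewrite gmom_rec// ih1 /= ih0 heat_polySS hornerD !hornerZ hornerM hornerX; by field.
Qed.

End HeatPoly.

Lemma deriv_prod_ord (R : comNzRingType) n (F : 'I_n -> {poly R}) :
  (\prod_(i < n) F i)^`() = \sum_(i < n) (F i)^`() * \prod_(j < n | j != i) F j.
Proof.
elim: n F => [|n ih] F; first by rewrite !big_ord0 -polyC1 derivC.
rewrite big_ord_recl derivM ih big_ord_recl; congr (_ * _ + _).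
  rewrite [RHS]big_mkcond big_ord_recl /= mul1r.
  by apply: eq_bigr => i _.
rewrite mulr_sumr; apply: eq_bigr => i _.
rewrite [in RHS]big_mkcond big_ord_recl /= mulrCA; congr (_ * (_ * _)).
rewrite [LHS]big_mkcond; apply: eq_bigr => j _.
by rewrite (inj_eq lift_inj).
Qed.

Section MatrixExp.
Variables (R : realType) (d k : nat).
Local Notation idx := (d.-tuple 'I_k.+1).
Implicit Types (a b c : idx) (x : d.-tuple R).

Definition heat_poly_prod a x : {poly R} := \prod_(i < d) heat_poly (tnth a i) (tnth x i).

(** The multi-index [alpha - 2 e_i], used only when the entry at [i] is at least 2, so that the
    subtraction does not truncate. *)
Definition sub2 a (i : 'I_d) : idx :=
  [tuple if j == i then inord (tnth a j - 2) else tnth a j | j < d].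

Lemma sub2P a i c : (2 <= tnth a i)%N ->
  (((tnth c i : nat) + 2 == tnth a i)%N && [forall j : 'I_d, (j != i) ==> ((tnth c j : nat) == tnth a j)])
  = (c == sub2 a i).
Proof.
move=> ai; apply/andP/eqP => [[/eqP h1 /forallP h2]|->].
  apply: eq_from_tnth => j; rewrite tnth_mktuple; apply: val_inj => /=.
  case: eqP => [->|/eqP ji].
    rewrite inordK -h1 ?addnK//; exact: ltn_ord.
  by have := h2 j; rewrite ji => /eqP.
split.
  rewrite tnth_mktuple eqxx inordK ?subnK//.
  by rewrite (leq_ltn_trans (leq_subr _ _))// ltn_ord.
by apply/forallP => j; apply/implyP => ji; rewrite tnth_mktuple (negPf ji).
Qed.

Lemma mdeg_sub2 a i : (2 <= tnth a i)%N -> (mdeg (sub2 a i) + 2 = mdeg a)%N.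
Proof.
move=> ai; rewrite /mdeg (bigD1 i)//= [RHS](bigD1 i)//= tnth_mktuple eqxx inordK; last first.
  by rewrite (leq_ltn_trans (leq_subr _ _))// ltn_ord.
rewrite addnAC subnK//; congr addn; apply: eq_bigr => j ji.
by rewrite tnth_mktuple (negPf ji).
Qed.

(** A row of [A] has at most one nonzero entry per coordinate. Values lie in an arbitrary module,
    since the lemma serves both for heat polynomials and for real row sums. *)
Lemma sum_Amat (V : lmodType R) a (F : idx -> V) : (mdeg a <= k)%N ->
  \sum_(c : idx | (mdeg c <= k)%N) Amat R a c *: F c =
  \sum_(i < d) (if (2 <= tnth a i)%N then (tnth a i * (tnth a i).-1)%:R *: F (sub2 a i) else 0).
Proof.
move=> ak; under eq_bigr do rewrite /Amat scaler_suml.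
rewrite exchange_big /=; apply: eq_bigr => i _.
case: ifPn => [ai|]; last first.
  rewrite -ltnNge => ai; rewrite big1// => c _; case: ifP => [/andP[/eqP h _]|]; last by rewrite scale0r.
  by move: ai; rewrite -h addn2.
rewrite (bigD1 (sub2 a i)) /=; last first.
  by rewrite -(leq_add2r 2) mdeg_sub2// (leq_trans ak)// leq_addr.
rewrite sub2P// eqxx big1 ?addr0// => c /andP[_ ci].
by rewrite sub2P// (negPf ci) scale0r.
Qed.

Lemma deriv_heat_poly_prod a x : (mdeg a <= k)%N ->
  (heat_poly_prod a x)^`() = \sum_(c : idx | (mdeg c <= k)%N) Amat R a c *: heat_poly_prod c x.
Proof.
move=> ak; rewrite (sum_Amat (fun c => heat_poly_prod c x))// deriv_prod_ord.
apply: eq_bigr => i _; rewrite deriv_heat_poly.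
case: ifPn => ai; last first.
  by have -> : (tnth a i * (tnth a i).-1 = 0)%N by [move: ai; case: (nat_of_ord (tnth a i)) => [|[|]]];
     rewrite scale0r mul0r.
rewrite -scalerAl; congr (_ *: _).
rewrite /heat_poly_prod [RHS](bigD1 i)//= tnth_mktuple eqxx inordK; last first.
  by rewrite (leq_ltn_trans (leq_subr _ _))// ltn_ord.
rewrite subn2; congr (_ * _); apply: eq_bigr => j ji.
by rewrite tnth_mktuple (negPf ji).
Qed.

Lemma derivn_heat_poly_prod j a x : (mdeg a <= k)%N ->
  (heat_poly_prod a x)^`(j) = \sum_(c : idx | (mdeg c <= k)%N) Apow R j a c *: heat_poly_prod c x.
Proof.
elim: j a => [|j ih] a ak.
  rewrite derivn0 (bigD1 a)//= eqxx scale1r big1 ?addr0// => c /andP[_ ca].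
  by rewrite eq_sym (negPf ca) scale0r.
rewrite derivSn deriv_heat_poly_prod// linear_sum /=.
under eq_bigr => c ck do rewrite linearZ /= ih// scaler_sumr.
rewrite exchange_big /=; apply: eq_bigr => b _.
by rewrite scaler_suml; apply: eq_bigr => c _; rewrite scalerA.
Qed.

Lemma Amat_ge0 a c : 0 <= Amat R a c.
Proof. by apply: sumr_ge0 => i _; case: ifP. Qed.

Lemma Apow_ge0 j a c : 0 <= Apow R j a c.
Proof.
elim: j a => [|j ih] a /=; first by case: (a == c).
by apply: sumr_ge0 => b _; rewrite mulr_ge0 ?Amat_ge0.
Qed.

(** Each application of [A] lowers the degree by 2, and a row of degree [m] sums to at most
    [m (m - 1)], as every entry of the multi-index is at most [m]. The product of [j] such factors
    is a falling factorial of length [2j]. *)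
Lemma Apow_row_sum j a : (mdeg a <= k)%N ->
  \sum_(b : idx | (mdeg b <= k)%N) Apow R j a b <= (mdeg a ^_ (j.*2))%:R.
Proof.
elim: j a => [|j ih] a ak /=.
  rewrite (bigD1 a)//= eqxx big1 ?addr0 ?ffactn0// => c /andP[_ ca].
  by rewrite eq_sym (negPf ca).
rewrite exchange_big /=.
under eq_bigr do rewrite -mulr_sumr.
apply: (@le_trans _ _ (\sum_(c : idx | (mdeg c <= k)%N) Amat R a c *: (((mdeg c) ^_ j.*2)%:R : R^o))).
  by apply: ler_sum => c ck; rewrite ler_wpM2l ?Amat_ge0// ih.
rewrite (sum_Amat (fun c => ((mdeg c) ^_ j.*2)%:R : R^o))//.
apply: (@le_trans _ _ (\sum_(i < d) (tnth a i * (mdeg a).-1)%:R * ((mdeg a - 2) ^_ j.*2)%:R)).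
  apply: ler_sum => i _; case: ifP => [ai|_]; last by rewrite mulr_ge0.
  rewrite -(mdeg_sub2 ai) addnK /GRing.scale /= ler_wpM2r// ler_nat leq_mul2l.
  apply/orP; right; rewrite -!subn1 leq_sub2r// mdeg_sub2//.
  by rewrite /mdeg (bigD1 i)//= leq_addr.
rewrite -mulr_suml -natr_sum -natrM -big_distrl /= -/(mdeg a) ler_nat.
case: (mdeg a) => [|[|n]]; rewrite ?mul0n ?muln0//.
by rewrite subSS subSS subn0 ffactSS ffactSS mulnA.
Qed.

(** Nilpotency of [A]: the entries of its powers are nonnegative and their row-sum bound is 0 once
    [2j] exceeds the degree. The exponential series is therefore a finite sum. *)
Lemma Apow_eq0 j a b : (mdeg a <= k)%N -> (mdeg b <= k)%N -> (k < j)%N -> Apow R j a b = 0.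
Proof.
move=> ak bk kj; apply/eqP; rewrite eq_le Apow_ge0 andbT.
have := Apow_row_sum j ak.
rewrite ffact_small; last by rewrite -addnn (leq_ltn_trans ak)// (leq_trans kj)// leq_addr.
apply: le_trans; rewrite (bigD1 b)//= lerDl.
by apply: sumr_ge0 => c _; exact: Apow_ge0.
Qed.

Lemma expA_y_sum (t : R) (y : idx -> R) a N : (mdeg a <= k)%N -> (k < N)%N ->
  expA_y t y a = \sum_(j < N) ((- t) ^+ j / (j`!)%:R) *
        \sum_(b : idx | (mdeg b <= k)%N) Apow R j a b * y b.
Proof.
move=> ak kN; rewrite /expA_y; apply/cvg_lim => //.
have E M : (k < M)%N -> \sum_(j < M) ((- t) ^+ j / (j`!)%:R) *
        \sum_(b : idx | (mdeg b <= k)%N) Apow R j a b * y b =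
   \sum_(j < k.+1) ((- t) ^+ j / (j`!)%:R) *
        \sum_(b : idx | (mdeg b <= k)%N) Apow R j a b * y b.
  move=> kM; rewrite [RHS](big_ord_widen M (fun j => ((- t) ^+ j / (j`!)%:R) *
        \sum_(b : idx | (mdeg b <= k)%N) Apow R j a b * y b))//.
  rewrite [RHS]big_mkcond; apply: eq_bigr => j _; case: ifPn => //; rewrite -leqNgt => kj.
  by rewrite [X in _ * X]big1 ?mulr0// => b bk; rewrite Apow_eq0 ?mul0r.
rewrite (E N)//; apply: cvg_near_cst; near=> M; apply: E.
by near: M; exact: nbhs_infty_gt.
Unshelve. all: by end_near.
Qed.

(** This is Taylor's formula in time, from [t] back to 0: time derivatives are powers of [A], and at
    time 0 a heat polynomial is a monomial. *)
Lemma expA_heat_poly_prod (t : R) a x : (mdeg a <= k)%N ->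
  expA_y t (fun b => (heat_poly_prod b x).[t]) a = monom a x.
Proof.
move=> ak; set p := heat_poly_prod a x.
(* Enough terms both for the exponential series and for the full Taylor expansion of [p]. *)
pose N := maxn k.+1 (size p).
rewrite (@expA_y_sum _ _ _ N)//; last by rewrite /N leq_max leqnn.
have -> : monom a x = p.[t + - t].
  rewrite subrr /p /heat_poly_prod horner_prod; apply: eq_bigr => i _.
  by rewrite heat_poly_at0.
rewrite (@nderiv_taylor_wide _ N) ?leq_maxr//; last exact: mulrC.
apply: eq_bigr => j _.
have -> : \sum_(b : idx | (mdeg b <= k)%N) Apow R j a b * (heat_poly_prod b x).[t] = (p^`(j)).[t].
  by rewrite derivn_heat_poly_prod// horner_sum; apply: eq_bigr => b _; rewrite hornerZ.
rewrite nderivn_def hornerMn -mulr_natr; field.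
by rewrite pnatr_eq0 -lt0n fact_gt0.
Qed.

Lemma expA_yD (t : R) (y z : idx -> R) a : (mdeg a <= k)%N ->
  expA_y t (fun b => y b + z b) a = expA_y t y a + expA_y t z a.
Proof.
move=> ak; rewrite !(@expA_y_sum _ _ _ k.+1)// -big_split /=; apply: eq_bigr => j _.
by rewrite -mulrDr -big_split /=; congr (_ * _); apply: eq_bigr => b _; rewrite mulrDr.
Qed.

End MatrixExp.

(** * Row sums of the matrix exponential *)

Lemma ffactDn m r : (m.+1 ^_ r.+1 = m ^_ r.+1 + r.+1 * m ^_ r)%N.
Proof.
rewrite ffactSS ffactnSr; have [rm|mr] := leqP r m.
  have -> : m.+1 = ((m - r) + r.+1)%N by lia.
  by rewrite mulnDl (mulnC (m - r)%N).
by rewrite ffact_small// !muln0.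
Qed.

Section RowSum.
Variable R : realType.

(** For large [N] this is the heat polynomial of index [n] at position 1 and time 1, whence the
    recurrence below. It bounds the absolute row sums of the exponential of [- A] on rows of degree
    [n]. *)
Definition heat_row_sum (n N : nat) : R := \sum_(j < N) (n ^_ j.*2)%:R / (j`!)%:R.

Lemma heat_row_sum_rec n N : heat_row_sum n.+2 N.+1 = heat_row_sum n.+1 N.+1 + (2 * n.+1)%:R * heat_row_sum n N.
Proof.
rewrite /heat_row_sum !big_ord_recl /= !ffactn0 -addrA; congr (_ + _).
rewrite mulr_sumr -big_split /=; apply: eq_bigr => j _.
rewrite /bump /= add1n doubleS (ffactDn n.+1 j.*2.+1).
move: (n.+1 ^_ j.*2.+2)%N => X; rewrite ffactSS factS natrD !natrM -!muln2.
have h1 : (j.+1%:R : R) != 0 by rewrite pnatr_eq0.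
have h2 : (j`!%:R : R) != 0 by rewrite pnatr_eq0 -lt0n fact_gt0.
have -> : ((j * 2).+2%:R : R) = 2 * j.+1%:R by rewrite -natrM; congr (_%:R); lia.
move: (j.+1%:R : R) h1 => J hJ; by field; rewrite hJ h2.
Qed.

Lemma heat_row_sum_small n N : (n <= 1)%N -> heat_row_sum n N <= 1.
Proof.
move=> n1; rewrite /heat_row_sum; case: N => [|N]; first by rewrite big_ord0.
rewrite big_ord_recl /= ffactn0 fact0 divr1 big1 ?addr0// => j _.
by rewrite ffact_small ?mul0r// /bump /= add1n doubleS; lia.
Qed.

(** With [q] the square root of [k], the recurrence closes because [2 q + 2 (n + 1) <= 4 q^2], using
    [n + 1 <= k] and [1 <= q]. *)
Lemma heat_row_sum_le k n N : (0 < k)%N -> (n <= k)%N -> heat_row_sum n N <= (2 * Num.sqrt k%:R) ^+ n.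
Proof.
move=> k0; set q : R := Num.sqrt k%:R.
have q1 : 1 <= q by rewrite -sqrtr1 ler_wsqrtr// ler1n.
have qk : q ^+ 2 = k%:R by rewrite sqr_sqrtr.
elim/nat_ind2: n N => [N _|N _|n ih0 ih1 [|N] nk].
- by rewrite expr0 heat_row_sum_small.
- by rewrite expr1 (le_trans (heat_row_sum_small _ _))//; nra.
- by rewrite /heat_row_sum big_ord0 exprn_ge0// mulr_ge0// (le_trans _ q1).
rewrite heat_row_sum_rec.
have h1 := ih1 N.+1 (ltnW nk); have h0 := ih0 N ltac:(lia).
apply: (@le_trans _ _ ((2 * q) ^+ n.+1 + (2 * n.+1)%:R * (2 * q) ^+ n)).
  by rewrite lerD// ler_wpM2l.
have p0 : 0 <= (2 * q) ^+ n by rewrite exprn_ge0// mulr_ge0// (le_trans _ q1).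
have nq : (n.+1%:R : R) <= q ^+ 2 by rewrite qk ler_nat; lia.
rewrite [X in X + _]exprS [leRHS]exprS [X in _ <= _ * X]exprS -mulrDl mulrA ler_wpM2r//.
rewrite natrM; nra.
Qed.

Lemma expR1_ge : 8 / 3 <= expR (1 : R).
Proof.
have := @exp_partial_sum_le R 4 1 ler01.
rewrite !big_ord_recl big_ord0 /= /bump /= !expr1n.
rewrite !add1n !factS fact0 !muln1 !natrM.
lra.
Qed.

(** The factor [2^k] of the previous bound is absorbed by the exponential. For [k >= 2] one has
    [e >= 8/3 = 4/3 * 2] and [sqrt (k / pi) >= 2/3], and [2/3 * (4/3)^2] exceeds 1. For [k = 1] the
    sum is at most 1, below [1/2 * 8/3]. *)
Lemma heat_row_sum_bound k n N : (0 < k)%N -> (n <= k)%N ->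
  heat_row_sum n N <= Num.sqrt (k%:R / pi) * (expR k%:R * Num.sqrt k%:R ^+ k).
Proof.
move=> k0 nk; have pi0 := @pi_gt0 R.
have pi4 : (pi : R) <= 4 by have := @pihalf_lt2 R; lra.
have e1 := expR1_ge.
have ek : expR k%:R = expR (1 : R) ^+ k by rewrite -expRM_natl mulr1.
have sqrt_ge (c : R) : 0 <= c -> c ^+ 2 * 4 <= k%:R -> c <= Num.sqrt (k%:R / pi).
  move=> c0 ck; rewrite -(ger0_norm c0) -sqrtr_sqr ler_wsqrtr// ler_pdivlMr//.
  have := sqr_ge0 c; nra.
have [k1|k2] := leqP k 1.
  have kE : k = 1%N by lia.
  subst k; rewrite (le_trans (heat_row_sum_small _ _))// sqrtr1 expr1n mulr1.
  have h : 2^-1 <= Num.sqrt (1%:R / pi : R) by apply: sqrt_ge; lra.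
  nra.
have h : (2 / 3 : R) <= Num.sqrt (k%:R / pi).
  apply: sqrt_ge; first lra.
  by have : (2%:R : R) <= k%:R; [rewrite ler_nat|lra].
have q1 : 1 <= Num.sqrt k%:R :> R by rewrite -{1}sqrtr1 ler_wsqrtr// ler1n.
apply: (le_trans (heat_row_sum_le N k0 nk)).
apply: (@le_trans _ _ ((2 * Num.sqrt k%:R) ^+ k)).
  by apply: ler_weXn2l => //; lra.
rewrite exprMn mulrA ler_wpM2r ?exprn_ge0//.
apply: (@le_trans _ _ (2 / 3 * (4 / 3 * 2) ^+ k)).
  rewrite exprMn mulrA ler_peMl ?exprn_ge0//.
  have : (4 / 3 : R) ^+ 2 <= (4 / 3) ^+ k by apply: ler_weXn2l => //; lra.
  lra.
have p0 : (0 : R) <= 4 / 3 * 2 by lra.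
rewrite ek; apply: ler_pM; [lra|exact: exprn_ge0|exact: h|].
by apply: lerXn2r; rewrite ?nnegrE//; lra.
Qed.

End RowSum.

Section ExpBound.
Variables (R : realType) (d k : nat).
Local Notation idx := (d.-tuple 'I_k.+1).
Hypothesis k_gt0 : (0 < k)%N.

(** Only the terms with [2j <= mdeg a] survive, so [j <= k./2] and [T^j] is at most the maximum in
    the bound; the remaining sum is [heat_row_sum]. *)
Lemma expA_y_le (T B : R) (y : idx -> R) (a : idx) : 0 < T -> 0 <= B -> (mdeg a <= k)%N ->
  (forall b : idx, (mdeg b <= k)%N -> `|y b| <= B) ->
  `|expA_y T y a| <= Num.sqrt (k%:R / pi) * (expR k%:R * Num.sqrt k%:R ^+ k) * Num.max (T ^+ k./2) 1 * B.
Proof.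
move=> T0 B0 ak yB; rewrite (@expA_y_sum _ _ _ _ _ _ k.+1)//.
set M := Num.max _ _.
have M1 : 1 <= M by rewrite le_max lexx orbT.
have M0 : 0 <= M by apply: le_trans M1.
apply: le_trans (ler_norm_sum _ _ _) _.
apply: (@le_trans _ _ (\sum_(j < k.+1) ((mdeg a ^_ j.*2)%:R / j`!%:R) * M * B)); last first.
  rewrite -!mulr_suml ler_wpM2r// ler_wpM2r//.
  exact: heat_row_sum_bound.
apply: ler_sum => j _; rewrite normrM.
have h1 : `|\sum_(b : idx | (mdeg b <= k)%N) Apow R j a b * y b| <= (mdeg a ^_ j.*2)%:R * B.
  apply: le_trans (ler_norm_sum _ _ _) _.
  apply: le_trans (ler_wpM2r B0 (Apow_row_sum R j ak)); rewrite mulr_suml.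
  by apply: ler_sum => b bk; rewrite normrM (ger0_norm (Apow_ge0 _ _ _ _)) ler_wpM2l ?Apow_ge0 ?yB.
apply: (@le_trans _ _ (T ^+ j / j`!%:R * ((mdeg a ^_ j.*2)%:R * B))).
  rewrite ler_pM// normrM normrX normrN (gtr0_norm T0) ger0_norm ?invr_ge0//.
have -> : T ^+ j / j`!%:R * ((mdeg a ^_ j.*2)%:R * B) = ((mdeg a ^_ j.*2)%:R / j`!%:R) * T ^+ j * B by ring.
rewrite ler_wpM2r//.
have [aj|aj] := ltnP (mdeg a) j.*2; first by rewrite ffact_small// !mul0r.
rewrite ler_wpM2l ?divr_ge0//.
have jk : (j <= k./2)%N by rewrite -[nat_of_ord j]doubleK half_leq// (leq_trans aj).
have [T1|T1] := leP T 1.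
  by rewrite (le_trans _ M1)// exprn_ile1// ltW.
by rewrite le_max (ler_weXn2l (ltW T1) jk).
Qed.

End ExpBound.

(** * Moments of the heat flow *)

Section BoundedMeasurable.
Variables (R : realType) (d : nat).
Local Notation pt := (d.-tuple R).
Implicit Types (f g : pt -> R) (u : sgn_measure R d) (D : set pt).

(** Such functions are integrable against every finite measure, and unlike integrability this
    property is stable under products. *)
Definition bmeas D f := measurable_fun D f /\ exists M, forall x, D x -> `|f x| <= M.

Lemma bmeas_cst D (c : R) : bmeas D (fun=> c).
Proof. by split; [exact: measurable_cst|exists `|c|]. Qed.

Lemma bmeasD D f g : bmeas D f -> bmeas D g -> bmeas D (fun x => f x + g x).
Proof.
move=> [mf [M hM]] [mg [N hN]]; split; first exact: measurable_funD.
by exists (M + N) => x Dx; rewrite (le_trans (ler_normD _ _))// lerD ?hM ?hN.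
Qed.

Lemma bmeasM D f g : bmeas D f -> bmeas D g -> bmeas D (fun x => f x * g x).
Proof.
move=> [mf [M hM]] [mg [N hN]]; split; first exact: measurable_funM.
by exists (M * N) => x Dx; rewrite normrM ler_pM ?hM ?hN.
Qed.

Lemma bmeas_sum D (I : Type) (s : seq I) (P : pred I) (F : I -> pt -> R) :
  (forall i, bmeas D (F i)) -> bmeas D (fun x => \sum_(i <- s | P i) F i x).
Proof.
move=> hF; elim: s => [|i s ih].
  by under eq_fun do rewrite big_nil; exact: bmeas_cst.
under eq_fun do rewrite big_cons; case: (P i) => //.
exact: bmeasD.
Qed.

Lemma bmeas_prod D (I : Type) (s : seq I) (P : pred I) (F : I -> pt -> R) :
  (forall i, bmeas D (F i)) -> bmeas D (fun x => \prod_(i <- s | P i) F i x).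
Proof.
move=> hF; elim: s => [|i s ih].
  by under eq_fun do rewrite big_nil; exact: bmeas_cst.
under eq_fun do rewrite big_cons; case: (P i) => //.
exact: bmeasM.
Qed.

Lemma bmeasX D f n : bmeas D f -> bmeas D (fun x => f x ^+ n).
Proof.
move=> hf; elim: n => [|n ih]; first by under eq_fun do rewrite expr0; exact: bmeas_cst.
by under eq_fun do rewrite exprS; exact: bmeasM.
Qed.

Lemma bmeas_tnth (r : R) (i : 'I_d) : bmeas (cube r) (fun x : pt => tnth x i).
Proof.
split; first by apply: measurable_funTS; exact: measurable_tnth.
by exists r => x /(_ i); rewrite ler_norml.
Qed.

Lemma sm_int_bmeasD u D f g : measurable D -> bmeas D f -> bmeas D g ->
  sm_int u D (fun x => f x + g x) = sm_int u D f + sm_int u D g.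
Proof. by move=> mD [mf [M hM]] [mg [N hN]]; exact: sm_intD hM hN. Qed.

Lemma sm_int_bmeasZ u D f (c : R) : measurable D -> bmeas D f ->
  sm_int u D (fun x => c * f x) = c * sm_int u D f.
Proof. by move=> mD [mf [M hM]]; exact: sm_intZ hM. Qed.

Lemma sm_int_sum u D (I : Type) (s : seq I) (P : pred I) (F : I -> pt -> R) :
  measurable D -> (forall i, bmeas D (F i)) ->
  sm_int u D (fun x => \sum_(i <- s | P i) F i x) = \sum_(i <- s | P i) sm_int u D (F i).
Proof.
move=> mD hF; elim: s => [|i s ih].
  rewrite big_nil; under [X in sm_int _ _ X]eq_fun do rewrite big_nil.
  by rewrite /sm_int !Rintegral_cst// !mul0r subr0.
rewrite big_cons; under [X in sm_int _ _ X]eq_fun do rewrite big_cons.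
case: ifP => // _; rewrite sm_int_bmeasD// ?ih//.
exact: bmeas_sum.
Qed.

Lemma eq_sm_int u D f g : (forall x, D x -> f x = g x) -> sm_int u D f = sm_int u D g.
Proof.
by move=> fg; rewrite /sm_int; congr (_ - _); apply: eq_Rintegral => x; rewrite inE; exact: fg.
Qed.

Variable k : nat.
Implicit Types (a b : d.-tuple 'I_k.+1).

Lemma bmeas_monom r a : bmeas (cube r) (monom a : pt -> R).
Proof. by apply: bmeas_prod => i; apply: bmeasX; exact: bmeas_tnth. Qed.

Lemma bmeas_polyfun r (c : d.-tuple 'I_k.+1 -> R) : bmeas (cube r) (polyfun c : pt -> R).
Proof.
by apply: bmeas_sum => a; apply: bmeasM; [exact: bmeas_cst|exact: bmeas_monom].
Qed.

Lemma bmeas_heat_poly_prod r (T : R) a : bmeas (cube r) (fun x : pt => (heat_poly_prod a x).[T]).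
Proof.
under eq_fun do rewrite /heat_poly_prod horner_prod.
apply: bmeas_prod => i; elim/nat_ind2: (nat_of_ord (tnth a i)) => [||n ih0 ih1].
- by under eq_fun do rewrite heat_poly0 hornerC; exact: bmeas_cst.
- by under eq_fun do rewrite heat_poly1 hornerC; exact: bmeas_tnth.
- under eq_fun do rewrite heat_polySS hornerD !hornerZ hornerM hornerX.
  apply: bmeasD; first by apply: bmeasM => //; exact: bmeas_tnth.
  by apply: bmeasM; [exact: bmeas_cst|apply: bmeasM => //; exact: bmeas_cst].
Qed.

End BoundedMeasurable.

Section HeatMoments.
Variables (R : realType) (d k : nat) (r T : R).
Local Notation pt := (d.-tuple R).
Hypothesis T_gt0 : 0 < T.
Let sg : R := Num.sqrt (2 * T).

Let sg_gt0 : 0 < sg. Proof. by rewrite sqrtr_gt0 mulr_gt0. Qed.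
Let sg2 : sg ^+ 2 = 2 * T. Proof. by rewrite sqr_sqrtr// mulr_ge0// ltW. Qed.

(** At time [T] the heat kernel is a Gaussian of variance [2 T] in each coordinate. *)
Lemma heat_kernel_prod (x y : pt) :
  heat_kernel (tsub x y) T = \prod_(i < d) normal_pdf (tnth y i) sg (tnth x i).
Proof.
have pi0 := @pi_gt0 R.
under eq_bigr do rewrite normal_pdfE ?lt0r_neq0 ?sg_gt0//.
rewrite big_split /= prodr_const card_ord /heat_kernel; congr (_ * _).
  have h0 : 0 <= 4 * pi * T by rewrite !mulr_ge0// ltW.
  rewrite powRN [d%:R / 2]mulrC powRrM powR12_sqrt// powR_mulrn ?sqrtr_ge0// -exprVn.
  rewrite /normal_peak sg2; congr ((Num.sqrt _)^-1 ^+ _); ring.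
rewrite -expR_sum; congr expR.
rewrite /enorm sqr_sqrtr; last by apply: sumr_ge0 => i _; exact: sqr_ge0.
rewrite mulNr mulr_suml -sumrN; apply: eq_bigr => i _.
by rewrite tnth_mktuple sg2; field; rewrite lt0r_neq0.
Qed.

Let D : set pt := cube r.
Let mD : measurable D. Proof. exact: measurable_cube. Qed.

Lemma measurable_normal_pdf_mean (t : R) : measurable_fun setT (fun s : R => normal_pdf s sg t).
Proof.
have -> : (fun s : R => normal_pdf s sg t) = normal_pdf t sg.
  apply/funext => s; rewrite !normal_pdfE ?lt0r_neq0 ?sg_gt0//; congr (_ * _).
  by rewrite /normal_fun; congr expR; ring.
exact: measurable_normal_pdf.
Qed.

Lemma bmeas_heat_kernel (x : pt) : bmeas setT (fun y => heat_kernel (tsub x y) T).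
Proof.
under eq_fun do rewrite heat_kernel_prod.
apply: bmeas_prod => i; split.
  exact: (measurableT_comp (measurable_normal_pdf_mean _) (measurable_tnth i)).
exists (normal_peak sg) => y _.
by rewrite ger0_norm ?normal_pdf_ge0// normal_pdf_ub// lt0r_neq0 ?sg_gt0.
Qed.

Lemma heat_sol_cube (u : sgn_measure R d) (x : pt) : vanishes_outside u D ->
  heat_sol u x T = sm_int u D (fun y => heat_kernel (tsub x y) T).
Proof.
move=> vu; have [mK [M hM]] := bmeas_heat_kernel x.
by rewrite /heat_sol (@sm_int_setT _ _ u D _ M)// => y; exact: hM.
Qed.

Variable a : d.-tuple 'I_k.+1.
(** The indicator confines the Gaussian means to the cube, which makes the integral bounds uniform
    over all [y]. Being idempotent, it may be repeated in every factor. *)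
Let f (i : 'I_d) (t : R) (y : pt) : R := \1_D y * (t ^+ tnth a i * normal_pdf (tnth y i) sg t).

Let f_meas i : measurable_fun setT (fun z : R * pt => f i z.1 z.2).
Proof.
apply: measurable_funM.
  exact: (measurableT_comp (measurable_indic mD) measurable_snd).
apply: measurable_funM; first by apply: measurable_funX; exact: measurable_fst.
under eq_fun do rewrite normal_pdfE ?lt0r_neq0 ?sg_gt0//.
apply: measurable_funM; first exact: measurable_cst.
apply: measurableT_comp => //; apply: measurable_funM; last exact: measurable_cst.
apply: measurableT_comp => //; apply: measurable_funX; apply: measurable_funB => //.
exact: (measurableT_comp (measurable_tnth i) measurable_snd).
Qed.

Let f_bounded i t : exists B, forall y, `|f i t y| <= B.
Proof.
exists (`|t ^+ tnth a i| * normal_peak sg) => y.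
rewrite /f indicE normrM -[leRHS]mul1r ler_pM//; first by case: (_ \in _); rewrite ?normr1 ?normr0.
rewrite normrM ler_wpM2l// ger0_norm ?normal_pdf_ge0//.
by rewrite normal_pdf_ub// lt0r_neq0 ?sg_gt0.
Qed.

Let f_int i y : (@lebesgue_measure R).-integrable setT (EFin \o (f i)^~ y).
Proof. exact: (integrableZl measurableT (\1_D y) (integrable_gmom sg_gt0 (tnth a i) (tnth y i))). Qed.

Let f_int_bound i : exists C, forall y, \int[@lebesgue_measure R]_t `|f i t y| <= C.
Proof.
exists (gmom_bound sg (tnth a i) r) => y.
rewrite /f indicE; have [Dy|Dy] := boolP (y \in D).
  under eq_Rintegral do rewrite mul1r.
  apply: gmom_abs_le; first exact: sg_gt0.
  by rewrite ler_norml; move: Dy; rewrite inE; apply.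
under eq_Rintegral do rewrite mul0r normr0.
by rewrite Rintegral_cst// mul0r gmom_bound_ge0.
Qed.

(** The kernel factors over the coordinates, so Fubini leaves one Gaussian moment per coordinate,
    each a heat polynomial at time [T]. *)
Lemma moment_heat_sol (u : sgn_measure R d) : vanishes_outside u D ->
  leb_int (fun x : pt => monom a x * heat_sol u x T) =
  sm_int u D (fun y => (heat_poly_prod a y).[T]).
Proof.
move=> vu.
have indM (g : pt -> R) (y : pt) : (g \_ D) y = \1_D y * g y.
  by rewrite patchE indicE; case: ifP => _; rewrite ?mul1r ?mul0r.
have prodE (F : 'I_d -> R) (y : pt) : \1_D y * \prod_(i < d) (\1_D y * F i) = \1_D y * \prod_(i < d) F i.
  rewrite indicE; case: (_ \in _); last by rewrite !mul0r.
  by congr (_ * _); apply: eq_bigr => i _; rewrite mul1r.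
have [h1 h2] : measurable_fun setT (\1_D : pt -> R) /\ exists H, forall y : pt, `|\1_D y : R| <= H.
  split; first exact: measurable_indic.
  by exists 1 => y; rewrite indicE; case: (_ \in _); rewrite ?normr1 ?normr0.
have := @leb_int_fubini _ _ _ (mu_plus u) (mu_minus u) d \1_D f h1 h2 f_meas f_bounded f_int f_int_bound.
set L := leb_int _; set Q := _ - _ => LQ.
transitivity L.
  congr leb_int; apply/funext => x; rewrite heat_sol_cube//.
  have [mK [M hM]] := bmeas_heat_kernel x.
  rewrite -(@sm_intZ _ _ u D _ (monom a x) M)//; last first.
  - by move=> y _; exact: hM.
  - exact: measurable_funTS.
  rewrite /sm_int; congr (_ - _); rewrite [LHS]Rintegral_mkcond; apply: eq_Rintegral => y _;
    by rewrite indM heat_kernel_prod /f prodE big_split.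
have fE i y : \int[@lebesgue_measure R]_t f i t y = \1_D y * (heat_poly (tnth a i) (tnth y i)).[T].
  have -> : T = sg ^+ 2 / 2 by rewrite sg2 mulrC mulKf.
  rewrite -(gmom_heat_poly _ _ sg_gt0) /gmom -RintegralZl//.
  exact: integrable_gmom sg_gt0 _ _.
rewrite LQ /Q /sm_int; congr (_ - _); rewrite [RHS]Rintegral_mkcond; apply: eq_Rintegral => y _;
  by rewrite indM (eq_bigr _ (fun i _ => fE i y)) prodE /heat_poly_prod horner_prod.
Qed.

End HeatMoments.

(** * The stability estimate *)

(** The exponential is a finite sum and commutes with the integral against [u]; under the integral
    it turns heat polynomials at time [T] back into monomials. *)
Lemma expA_moments (R : realType) (d k : nat) (r T : R) (u : sgn_measure R d) (a : d.-tuple 'I_k.+1) :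
  0 < T -> vanishes_outside u (cube r) -> (mdeg a <= k)%N ->
  expA_y T (fun b : d.-tuple 'I_k.+1 => leb_int (fun x : d.-tuple R => monom b x * heat_sol u x T)) a
  = sm_int u (cube r) (monom a).
Proof.
move=> T0 vu ak; have mD := @measurable_cube R d r.
rewrite (@expA_y_sum _ _ _ _ _ _ k.+1)//.
have -> : sm_int u (cube r) (monom a) = sm_int u (cube r) (fun x => \sum_(j < k.+1)
   ((- T) ^+ j / (j`!)%:R) * \sum_(b : d.-tuple 'I_k.+1 | (mdeg b <= k)%N) Apow R j a b * (heat_poly_prod b x).[T]).
  by apply: eq_sm_int => x _; rewrite -(expA_heat_poly_prod T x ak) (@expA_y_sum _ _ _ _ _ _ k.+1).
have bA j b : bmeas (cube r) (fun x : d.-tuple R => Apow R j a b * (heat_poly_prod b x).[T]).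
  by apply: bmeasM; [exact: bmeas_cst|exact: bmeas_heat_poly_prod].
have bS j : bmeas (cube r) (fun x : d.-tuple R =>
    \sum_(b : d.-tuple 'I_k.+1 | (mdeg b <= k)%N) Apow R j a b * (heat_poly_prod b x).[T]).
  exact: bmeas_sum.
rewrite sm_int_sum//; last by move=> j; apply: bmeasM => //; exact: bmeas_cst.
apply: eq_bigr => j _; rewrite sm_int_bmeasZ//; congr (_ * _).
rewrite sm_int_sum//; apply: eq_bigr => b _; rewrite sm_int_bmeasZ//; last exact: bmeas_heat_poly_prod.
by rewrite (moment_heat_sol T0 _ vu).
Qed.

(** * Discrete measures with prescribed moments *)

Section Interpolation.
Variables (R : realType) (k : nat).
Hypothesis k_gt0 : (0 < k)%N.

(** Padding with points of weight 0 gives all the functionals the same number of nodes, so that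
    their tensor products are indexed by tuples. *)
Lemma coef0_functional_uniform : exists (n : nat) (c x : 'I_k.+1 -> 'I_n -> R),
  [/\ forall (j : 'I_k.+1) i, `|x j i| <= 1,
      forall (j : 'I_k.+1), \sum_(i < n) `|c j i| <= (2 * k%:R) ^+ j &
      forall (j : 'I_k.+1) (p : {poly R}), (size p <= k.+1)%N -> p`_j * (j`!)%:R = \sum_(i < n) c j i * p.[x j i]].
Proof.
have /choice[s hs] : forall j : 'I_k.+1, exists s : seq (R * R), \sum_(z <- s) `|z.1| <= (2 * k%:R) ^+ j /\
    forall p : {poly R}, (size p <= k.+1)%N -> p`_j * (j`!)%:R = \sum_(z <- s) z.1 * p.[cos z.2].
  by move=> j; apply: coef0_functional => //; rewrite -ltnS.
pose n := (\max_(j < k.+1) size (s j))%N.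
have sn j : (size (s j) <= n)%N by exact: (leq_bigmax j).
have sumE j (F : R * R -> R) : F (0, 0) = 0 ->
    \sum_(z <- s j) F z = \sum_(i < n) F (nth (0, 0) (s j) i).
  move=> F0; rewrite (big_nth (0, 0)) big_mkord (big_ord_widen n (fun i => F (nth (0, 0) (s j) i)))//.
  rewrite big_mkcond; apply: eq_bigr => i _; case: ltnP => // h.
  by rewrite nth_default.
exists n, (fun j i => (nth (0, 0) (s j) i).1), (fun j i => cos (nth (0, 0) (s j) i).2); split.
- by move=> j i; exact: cos_max.
- by move=> j; rewrite -(sumE j (fun z => `|z.1|)) ?normr0//; exact: (hs j).1.
- move=> j p sp; rewrite (hs j).2//.
  by rewrite -(sumE j (fun z => z.1 * p.[cos z.2])) ?mul0r.
Qed.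

Variables (d : nat) (r : R).
Hypothesis r_gt0 : 0 < r.
Local Notation idx := (d.-tuple 'I_k.+1).

(** Tensor products of the rescaled coefficient functionals are dual to the monomials; combining
    them with coefficients [delta] gives the required moments. Their masses are bounded by products
    of terms of the exponential series of [2k / r]. *)
Lemma discrete_measure_moments (delta : idx -> R) (B : R) : 0 <= B ->
  (forall a : idx, (mdeg a <= k)%N -> `|delta a| <= B) ->
  exists s : seq (R * d.-tuple R),
    [/\ forall z, z \in s -> cube r z.2,
        \sum_(z <- s) `|z.1| <= B * expR (2 * k%:R / r) ^+ d &
        forall b : idx, (mdeg b <= k)%N -> \sum_(z <- s) z.1 * monom b z.2 = delta b].
Proof.
move=> B0 hdelta.
have [n [c [x [hx hc hp]]]] := coef0_functional_uniform.
have rn0 := lt0r_neq0 r_gt0.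
(* Dividing by [j!] turns a derivative at 0 into a coefficient; dividing by [r^j] compensates for
   scaling the nodes to [-r, r]. *)
pose w (j : 'I_k.+1) (i : 'I_n) : R := c j i / (j`!%:R * r ^+ j).
have den0 (j : nat) : 0 < (j`!)%:R * r ^+ j by rewrite mulr_gt0 ?exprn_gt0// ltr0n fact_gt0.
pose P (a : idx) (q : d.-tuple 'I_n) : d.-tuple R := [tuple r * x (tnth a i) (tnth q i) | i < d].
pose W (a : idx) (q : d.-tuple 'I_n) : R := \prod_(i < d) w (tnth a i) (tnth q i).
pose s := [seq (delta a * W a q, P a q) | a <- [seq a <- index_enum idx | (mdeg a <= k)%N], q <- index_enum (d.-tuple 'I_n)].
have sumE (F : R * d.-tuple R -> R) : \sum_(z <- s) F z =
    \sum_(a : idx | (mdeg a <= k)%N) \sum_(q : d.-tuple 'I_n) F (delta a * W a q, P a q).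
  by rewrite /s big_allpairs_dep big_filter.
exists s; split.
- move=> z /allpairsPdep[a [q [_ _ ->]]] i /=.
  rewrite tnth_mktuple -ler_norml normrM gtr0_norm//.
  by rewrite ger_pMr.
- rewrite sumE /=.
  pose N (j : 'I_k.+1) : R := (2 * k%:R / r) ^+ j / j`!%:R.
  have z0 : 0 <= 2 * k%:R / r by rewrite divr_ge0 ?mulr_ge0// ltW.
  have N0 j : 0 <= N j by rewrite divr_ge0// exprn_ge0.
  have wN j : \sum_(i < n) `|w j i| <= N j.
    rewrite /w; under eq_bigr do rewrite normrM (@ger0_norm _ (_^-1)) ?invr_ge0 ?(ltW (den0 _))//.
    rewrite -mulr_suml ler_pdivrMr//.
    have -> : N j * (j`!%:R * r ^+ j) = (2 * k%:R) ^+ j.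
      by rewrite /N exprMn exprVn; field; rewrite expf_neq0// pnatr_eq0 -lt0n fact_gt0.
    exact: hc.
  apply: (@le_trans _ _ (\sum_(a : idx | (mdeg a <= k)%N) B * \prod_(i < d) N (tnth a i))).
    apply: ler_sum => a ak.
    under eq_bigr do rewrite normrM /W normr_prod.
    rewrite -mulr_sumr ler_pM ?hdelta//; first by apply: sumr_ge0 => q _; apply: prodr_ge0.
    rewrite -(prod_sum_tuple (fun i (q : 'I_n) => `|w (tnth a i) q|)).
    by apply: ler_prod => i _; rewrite wN sumr_ge0.
  rewrite -mulr_sumr ler_wpM2l//.
  (* Dropping the degree constraint lets the sum factor into [d] partial sums of the exponential. *)
  apply: (@le_trans _ _ (\sum_(a : idx) \prod_(i < d) N (tnth a i))).
    rewrite [leLHS]big_mkcond; apply: ler_sum => a _; case: ifP => // _.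
    exact: prodr_ge0.
  rewrite -(prod_sum_tuple (fun _ => N)) prodr_const card_ord.
  by rewrite lerXn2r ?nnegrE ?expR_ge0 ?sumr_ge0//; exact: exp_partial_sum_le.
- move=> b bk; rewrite sumE /=.
  have wM (j l : 'I_k.+1) : \sum_(i < n) w j i * (r * x j i) ^+ l = (j == l)%:R.
    transitivity (r ^+ l / (j`!%:R * r ^+ j) * (('X^l : {poly R})`_j * j`!%:R)).
      rewrite hp ?size_polyXn// mulr_sumr; apply: eq_bigr => i _.
      rewrite hornerXn exprMn /w; ring.
    rewrite coefXn; case: (eqVneq j l) => [->|jl].
      rewrite !eqxx /= mul1r; field.
      by rewrite expf_neq0// pnatr_eq0 -lt0n fact_gt0.
    by rewrite -val_eqE in jl; rewrite (negPf jl) mul0r mulr0.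
  have inner (a : idx) : \sum_(q : d.-tuple 'I_n) delta a * W a q * monom b (P a q) = delta a * (a == b)%:R.
    under eq_bigr do rewrite -mulrA; rewrite -mulr_sumr; congr (_ * _).
    under eq_bigr => q _.
      rewrite /W /monom -big_split /=.
      under eq_bigr => i _ do rewrite tnth_mktuple.
      over.
    rewrite -(prod_sum_tuple (fun i (q : 'I_n) => w (tnth a i) q * (r * x (tnth a i) q) ^+ tnth b i)).
    under eq_bigr do rewrite wM.
    case: eqVneq => [->|ab]; first by rewrite big1// => i _; rewrite eqxx.
    have [i hi] : exists i, tnth a i != tnth b i.
      apply/existsP; apply: contraNT ab; rewrite negb_exists => /forallP h.
      by apply/eqP; apply: eq_from_tnth => i; apply/eqP; have := h i; rewrite negbK.
    by rewrite (bigD1 i)//= (negPf hi) mul0r.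
  under eq_bigr do rewrite inner.
  by rewrite (bigD1 b)//= eqxx mulr1 big1 ?addr0// => a /andP[_ /negPf ->]; rewrite mulr0.
Qed.

End Interpolation.

(** Jackson's theorem exhibits [v] as a pointwise limit of polynomials on the cube. *)
Lemma measurable_lipschitz_cube (R : realType) (d : nat) (r : R) (v : d.-tuple R -> R) :
  (0 < d)%N -> 0 < r ->
  (forall x y, cube r x -> cube r y -> `|v x - v y| <= enorm (tsub x y)) ->
  measurable_fun (cube r) v.
Proof.
move=> d0 r0 hv; have mD := @measurable_cube R d r.
have /choice[p hp] : forall n : nat, exists p : d.-tuple R -> R, measurable_fun (cube r) p /\
    forall x, cube r x -> `|v x - p x| <= (d ^ 2)%:R * pi * r / n.+1%:R.
  move=> n; have [c hc] := jackson_multi d0 (ltn0Sn n) r0 hv.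
  by exists (polyfun c); split => //; exact: (bmeas_polyfun r c).1.
apply/measurable_EFinP.
apply: (emeasurable_fun_cvg (fun n => EFin \o p n)).
  by move=> n; apply/measurable_EFinP; exact: (hp n).1.
move=> x Dx; apply: cvg_EFin; first exact: nearW.
pose C := (d ^ 2)%:R * pi * r.
have h0 : (v x - p n x) @[n --> \oo] --> 0.
  apply/norm_cvg0P.
  apply: (@squeeze_cvgr _ _ _ _ (fun=> 0) (fun n : nat => C * n.+1%:R^-1)).
  - by near=> n; rewrite normr_ge0 (hp n).2.
  - exact: cvg_cst.
  - rewrite -[X in _ --> X](mulr0 C); apply: cvgM; first exact: cvg_cst.
    exact: cvg_harmonic.
have -> : fine \o (fun n => (EFin \o p n) x) = (fun n => v x - (v x - p n x)).
  by apply/funext => n; rewrite /= subKr.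
by rewrite -[X in _ --> X]subr0; apply: cvgB; [exact: cvg_cst|exact: h0].
Unshelve. all: by end_near.
Qed.

(** The form in which the constant leaves the estimate: [sqrt (k / pi)] factors out of the sum, and
    [k ln (sqrt k)] exponentiates to a power of [sqrt k]. *)
Lemma CdR_split (R : realType) (d k : nat) (Cd r : R) : (0 < k)%N ->
  CdR d Cd r k = (1 + Cd * r / k%:R) *
    (expR (2 * k%:R / r) ^+ d * (Num.sqrt (k%:R / pi) * (expR k%:R * Num.sqrt k%:R ^+ k))).
Proof.
move=> k0; have k1 : (0 : R) < k%:R by rewrite ltr0n.
have pi0 := @pi_gt0 R.
rewrite /CdR; set q : R := Num.sqrt k%:R; set s : R := Num.sqrt pi.
have q0 : 0 < q by rewrite sqrtr_gt0.
have s0 : 0 < s by rewrite sqrtr_gt0.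
have -> : Num.sqrt (k%:R / pi) = q / s by rewrite sqrtrM ?sqrtrV// ltW.
have -> : Num.sqrt (pi * k%:R) = s * q by rewrite sqrtrM// ltW.
have -> : expR (k%:R * (1 + 2 * d%:R / r + ln q)) = expR k%:R * expR (2 * k%:R / r) ^+ d * q ^+ k.
  have -> : k%:R * (1 + 2 * d%:R / r + ln q) = k%:R + d%:R * (2 * k%:R / r) + k%:R * ln q by ring.
  by rewrite !expRD !expRM_natl lnK.
have qq : k%:R = q * q by rewrite -expr2 sqr_sqrtr// ltW.
rewrite [in Cd * r / k%:R]qq; field.
by rewrite !lt0r_neq0.
Qed.

Section Stability.
Variables (R : realType) (d k : nat) (r T : R) (y : d.-tuple 'I_k.+1 -> R).
Variables (u0s u0k : sgn_measure R d).
Hypotheses (d_gt0 : (0 < d)%N) (k_gt0 : (0 < k)%N) (r_gt0 : 0 < r) (T_gt0 : 0 < T).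
Local Notation Om := (cube (d:=d) r).
Hypotheses (vanish : vanishes_outside u0s Om) (solves : solves_P Om T y u0k).
Local Notation idx := (d.-tuple 'I_k.+1).

(** [eta] is the Jackson error on the cube; [N] bounds the mass of the discrete correction. *)
Let eta : R := (d ^ 2)%:R * pi * r / k%:R.
Let N : R := expR (2 * k%:R / r) ^+ d * (Num.sqrt (k%:R / pi) * (expR k%:R * Num.sqrt k%:R ^+ k))
  * Num.max (T ^+ k./2) 1 * obs_err_norm T y u0s.

Lemma obs_err_norm_ge0 : 0 <= obs_err_norm T y u0s.
Proof.
by rewrite /obs_err_norm; elim/big_ind: _ => // a b a0 b0; rewrite le_max a0.
Qed.

Lemma obs_err_le (b : idx) : (mdeg b <= k)%N -> `|obs_err T y u0s b| <= obs_err_norm T y u0s.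
Proof.
move=> bk; rewrite /obs_err_norm (bigD1 b)//= le_max lexx //.
Qed.

Lemma moment_gap (a : idx) : (mdeg a <= k)%N ->
  expA_y T y a = sm_int u0s Om (monom a) + expA_y T (obs_err T y u0s) a.
Proof.
move=> ak; rewrite -(expA_moments T_gt0 vanish ak) -expA_yD//; congr expA_y.
by apply/funext => b; rewrite /obs_err addrC subrK.
Qed.

(** The solution and the competitor both have total variation at most that of [u0s] plus [N], and
    each contributes [eta] times this. The last [N] pays for returning from the competitor to [u0s],
    as [|v| <= 1] at the correction points. *)
Lemma kant_element_le (v : d.-tuple R -> R) :
  (forall x, Om x -> `|v x| <= 1) ->
  (forall x z, Om x -> Om z -> `|v x - v z| <= enorm (tsub x z)) ->
  sm_int u0k Om v - sm_int u0s Om v <= 2 * eta * tv_norm u0s + (1 + 2 * eta) * N.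
Proof.
move=> v1 hv; have mD := @measurable_cube R d r.
have mv : measurable_fun Om v by exact: measurable_lipschitz_cube hv.
have bv : bmeas Om v by split; [|exists 1].
have [c hc] := jackson_multi d_gt0 k_gt0 r_gt0 hv.
have eta0 : 0 <= eta by rewrite divr_ge0// !mulr_ge0// ?pi_ge0// ltW.
pose delta (a : idx) := expA_y T (obs_err T y u0s) a.
pose B := Num.sqrt (k%:R / pi) * (expR k%:R * Num.sqrt k%:R ^+ k) * Num.max (T ^+ k./2) 1 * obs_err_norm T y u0s.
have B0 : 0 <= B.
  apply: mulr_ge0; last exact: obs_err_norm_ge0.
  apply: mulr_ge0; last by rewrite le_max ler01 orbT.
  apply: mulr_ge0; first exact: sqrtr_ge0.
  by apply: mulr_ge0; [exact: expR_ge0|apply: exprn_ge0; exact: sqrtr_ge0].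
have hdelta (a : idx) : (mdeg a <= k)%N -> `|delta a| <= B.
  by move=> ak; apply: expA_y_le => //; [exact: obs_err_norm_ge0|exact: obs_err_le].
have [s [sD sN sM]] := discrete_measure_moments k_gt0 r_gt0 B0 hdelta.
have {}sN : \sum_(z <- s) `|z.1| <= N by apply: le_trans sN _; rewrite /N /B; lra.
pose u' := sm_add_diracs u0s s.
have u'int f : bmeas Om f -> sm_int u' Om f = sm_int u0s Om f + \sum_(z <- s) z.1 * f z.2.
  by move=> [mf [M hM]]; exact: (sm_int_add_diracs _ mD mf hM sD).
have feas : feasible_P Om T y u'.
  split; first exact: vanishes_add_diracs.
  move=> a ak; rewrite u'int ?sM// ?moment_gap//; exact: bmeas_monom.
have [[vk mk] mink] := solves.
have tvk : tv_norm u0k <= tv_norm u0s + N.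
  apply: le_trans (mink _ feas) _; apply: le_trans (tv_norm_add_diracs _ _) _.
  by rewrite lerD2l.
have tv' : tv_norm u' <= tv_norm u0s + N.
  by apply: le_trans (tv_norm_add_diracs _ _) _; rewrite lerD2l.
have polyE : sm_int u0k Om (polyfun c) = sm_int u' Om (polyfun c).
  have E u : feasible_P Om T y u -> sm_int u Om (polyfun c) =
      \sum_(a : idx | (mdeg a <= k)%N) c a * expA_y T y a.
    move=> [_ hu]; rewrite /polyfun sm_int_sum//.
      apply: eq_bigr => a ak; rewrite sm_int_bmeasZ// ?hu//; exact: bmeas_monom.
    by move=> a; apply: bmeasM; [exact: bmeas_cst|exact: bmeas_monom].
  by rewrite !E//; split.
pose g x := v x + (-1) * polyfun c x.
have bp : bmeas Om (fun x => (-1) * polyfun c x).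
  by apply: bmeasM; [exact: bmeas_cst|exact: bmeas_polyfun].
have bg : bmeas Om g by exact: bmeasD.
have gE u : sm_int u Om v = sm_int u Om g + sm_int u Om (polyfun c).
  rewrite /g sm_int_bmeasD// sm_int_bmeasZ//; last exact: bmeas_polyfun.
  by rewrite mulN1r subrK.
have gle u : `|sm_int u Om g| <= eta * tv_norm u.
  apply: sm_int_le_tv => //; first exact: bg.1.
  by move=> x Dx; rewrite /g mulN1r; exact: hc.
have vs : `|\sum_(z <- s) z.1 * v z.2| <= N.
  apply: le_trans sN; apply: le_trans (ler_norm_sum _ _ _) _.
  rewrite big_seq [leRHS]big_seq; apply: ler_sum => z zs.
  by rewrite normrM ler_piMr// v1//; exact: sD.
(* The polynomial part cancels, both measures being feasible and so sharing their moments. *)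
have -> : sm_int u0k Om v - sm_int u0s Om v =
    sm_int u0k Om g - sm_int u' Om g + \sum_(z <- s) z.1 * v z.2.
  have := u'int v bv; rewrite (gE u0k) (gE u') polyE; lra.
have := gle u0k; have := gle u'; rewrite !ler_norml => /andP[h1 _] /andP[_ h2].
move: vs; rewrite ler_norml => /andP[_ h3].
have e1 := ler_wpM2l eta0 tvk; have e2 := ler_wpM2l eta0 tv'.
lra.
Qed.

End Stability.

Theorem mainTheorem2 (R : realType) (d : nat) (hd : (0 < d)%N) :
  exists Cd : R, 0 < Cd /\
  forall (r : R) (k : nat) (T : R) (y : d.-tuple 'I_k.+1 -> R)
         (u0s u0k : sgn_measure R d),
    0 < r -> (1 <= k)%N -> 0 < T ->
    vanishes_outside u0s (cube (d:=d) r) ->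
    solves_P (cube (d:=d) r) T y u0k ->
    kant_norm_diff u0k u0s (cube (d:=d) r) <=
      Cd * r * tv_norm u0s / k%:R
      + CdR d Cd r k * Num.max (T ^+ k./2) 1 * obs_err_norm T y u0s.
Proof.
(* Twice the Jackson constant, so that [Cd * r / k] is exactly [2 * eta]. *)
exists (2 * (d ^ 2)%:R * pi); split.
  by rewrite !mulr_gt0 ?pi_gt0// ltr0n expn_gt0 hd.
move=> r k T y u0s u0k r0 k0 T0 vanish solves.
apply: ge_sup.
  (* The zero test function shows that the supremum is over a nonempty set. *)
  exists (sm_int u0k (cube r) (fun=> 0) - sm_int u0s (cube r) (fun=> 0)), (fun=> 0).
  by split; [|split] => // [x _|x z _ _]; rewrite ?subr0 normr0// sqrtr_ge0.
move=> _ [v [v1 [hv ->]]].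
apply: le_trans (kant_element_le hd k0 r0 T0 vanish solves v1 hv) _.
rewrite CdR_split//.
set X := expR _ ^+ d * _; rewrite le_eqVlt; apply/orP; left; apply/eqP.
by field; rewrite lt0r_neq0// ltr0n.
Qed.
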